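(* Let $\phi\in L^\infty(\mathbb T)$ and suppose that the Toeplitz operator $T_\phi$ on $H^2$ is hyponormal with finite rank self-commutator $[T_\phi^*,T_\phi]$. If $\ker\,[T_\phi^*,T_\phi]$ is invariant under $T_\phi$ and, for some $b\in\mathcal E(\phi)$, $b\,\ker\,[T_\phi^*,T_\phi]$ is invariant under $T_\phi$, then $T_\phi$ is normal or analytic.
   Context: $H^2$ is the Hardy space of the unit circle $\mathbb T$, $P$ is the orthogonal projection of $L^2(\mathbb T)$ onto $H^2$, and $T_\phi g=P(\phi g)$ for $g\in H^2$. $T_\phi$ is called analytic if $\phi\in H^\infty$. $[T^*,T]:=T^*T-TT^*$, and $T$ is hyponormal if $[T^*,T]\ge0$. For $\phi\in L^\infty$, $$\mathcal E(\phi):=\{k\in H^\infty:\ \|k\|_\infty\le1\ \text{and}\ \phi-k\overline\phi\in H^\infty\}.$$ For $b\in H^\infty$ and a subspace $\mathcal M\subseteq H^2$, $b\,\mathcal M:=\{bf: f\in\mathcal M\}$. *)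

(* Defs.v *)
From HB Require Import structures.
From mathcomp Require Import all_boot all_order all_algebra.
From mathcomp Require Import complex.
From mathcomp Require Import all_classical all_reals all_analysis.

Set Implicit Arguments.
Unset Strict Implicit.
Unset Printing Implicit Defensive.

Import Order.TTheory GRing.Theory Num.Theory.
Import numFieldNormedType.Exports.

Local Open Scope classical_set_scope.
Local Open Scope ring_scope.
Local Open Scope complex_scope.

(* A function on the unit circle is encoded as a function of the angle t in    *)
(* [0, 2 pi]. Normalized arc length is the uniform probability on that         *)
(* interval; values outside [0, 2 pi] are irrelevant. Elements of L^p and H^p  *)
(* are measurable representatives, compared up to equality a.e.                *)

Lemma twopi_gt0 (R : realType) : 0 < pi *+ 2 :> R.
Proof. by rewrite pmulrn_lgt0 // pi_gt0. Qed.

Definition circle_prob (R : realType) : probability (measurableTypeR R) R :=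
  uniform_prob (@twopi_gt0 R).

Definition normLp (R : realType) (p : \bar R) (f : R -> R[i]) : \bar R :=
  Lnorm (circle_prob R) p (fun t => (Normc.normc (f t))%:E).

Definition Lp (R : realType) (p : \bar R) : set (R -> R[i]) :=
  [set f : R -> R[i] |
    [/\ measurable_fun setT (fun t : measurableTypeR R => complex.Re (f t)),
        measurable_fun setT (fun t : measurableTypeR R => complex.Im (f t)) &
        (normLp p f < +oo)%E]].

Definition integral_circle (R : realType) (f : R -> R[i]) : R[i] :=
  (\int[circle_prob R]_t complex.Re (f t)) +i*
  (\int[circle_prob R]_t complex.Im (f t)).

Definition dotL2 (R : realType) (f g : R -> R[i]) : R[i] :=
  integral_circle (fun t => f t * conjc (g t)).

Definition circle_var (R : realType) (t : R) : R[i] := cos t +i* sin t.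

Definition fourier_coef (R : realType) (f : R -> R[i]) (n : int) : R[i] :=
  dotL2 f (fun t => circle_var t ^ n).

Definition H2 (R : realType) : set (R -> R[i]) :=
  [set f | Lp 2%:E f /\ forall n : int, n < 0 -> fourier_coef f n = 0].

Definition Hinf (R : realType) : set (R -> R[i]) :=
  [set f | Lp +oo%E f /\ forall n : int, n < 0 -> fourier_coef f n = 0].

(* [xget] selects a representative of the class, which is unique a.e.; the     *)
(* default value is not used when f is in L^2.                                 *)
Definition projH2 (R : realType) (f : R -> R[i]) : R -> R[i] :=
  xget (cst 0) [set h | H2 h /\
    forall g, H2 g -> dotL2 (fun t => f t - h t) g = 0].

Definition toeplitz (R : realType) (phi g : R -> R[i]) : R -> R[i] :=
  projH2 (fun t => phi t * g t).

(* Hilbert-space adjoint of an operator on H^2, again as a representative.     *)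
Definition adjH2 (R : realType) (T : (R -> R[i]) -> R -> R[i])
    (g : R -> R[i]) : R -> R[i] :=
  xget (cst 0) [set h | H2 h /\
    forall f, H2 f -> dotL2 (T f) g = dotL2 f h].

Definition selfcomm (R : realType) (T : (R -> R[i]) -> R -> R[i])
    (f : R -> R[i]) : R -> R[i] :=
  fun t => adjH2 T (T f) t - T (adjH2 T f) t.

(* The order of R[i]: 0 <= z means that z is real and nonnegative.             *)
Definition hyponormal (R : realType) (T : (R -> R[i]) -> R -> R[i]) : Prop :=
  forall f, H2 f -> 0 <= dotL2 (selfcomm T f) f.

Definition normal_op (R : realType) (T : (R -> R[i]) -> R -> R[i]) : Prop :=
  forall f, H2 f -> adjH2 T (T f) = T (adjH2 T f) %[ae circle_prob R].

Definition finite_rank (R : realType) (A : (R -> R[i]) -> R -> R[i]) : Prop :=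
  exists (n : nat) (e : 'I_n -> R -> R[i]),
    (forall j, H2 (e j)) /\ forall f, H2 f ->
      exists c : 'I_n -> R[i],
        A f = (fun t => \sum_(j < n) c j * e j t) %[ae circle_prob R].

Definition kerH2 (R : realType) (A : (R -> R[i]) -> R -> R[i]) :
    set (R -> R[i]) :=
  [set f | H2 f /\ A f = cst 0 %[ae circle_prob R]].

Definition invariant_under (R : realType) (T : (R -> R[i]) -> R -> R[i])
    (M : set (R -> R[i])) : Prop :=
  forall f, M f -> exists2 g, M g & T f = g %[ae circle_prob R].

Definition mulspace (R : realType) (b : R -> R[i]) (M : set (R -> R[i])) :
    set (R -> R[i]) :=
  [set (fun t => b t * f t) | f in M].

Definition analytic_symbol (R : realType) (phi : R -> R[i]) : Prop := Hinf phi.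

Definition calE (R : realType) (phi : R -> R[i]) : set (R -> R[i]) :=
  [set k | [/\ Hinf k, (normLp +oo k <= 1)%E &
               Hinf (fun t => phi t - k t * conjc (phi t))]].

(* Main.v *)
Require Import Defs.
From HB Require Import structures.
From mathcomp Require Import all_boot all_order all_algebra.
From mathcomp Require Import complex ring lra zify.
From mathcomp Require Import all_classical all_reals all_analysis.
From mathcomp Require Import measurable_realfun ess_sup_inf.

(* Write u = (I - P)(conj(phi) f), v = (I - P)(phi f), h = phi - b conj(phi) and K for the kernel of
   the self-commutator. Then b u - v = T_phi f - h f - b P(conj(phi) f) lies in H^2, and
   <[T*, T] f, f> = |u|^2 - |v|^2 = (|u|^2 - |b u|^2) + |b u - v|^2, so f is in K exactly when
   b u = v and |b|^2 u = u almost everywhere.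
   - If |b| = 1 a.e., invariance of b K gives b K <= K with u_{b f} = b u_f, so b^n u_f is
     orthogonal to H^2 for all n. If |b_0| < 1 for the constant coefficient b_0 this forces u_f = 0;
     otherwise b is constant, K is everything and T_phi is normal.
   - If |b| < 1 on a set of positive measure, u_f vanishes there, and since K has finite codimension
     a polynomial multiple of f gives again u_f = 0.
   - If u_f = 0 on K, then phi K <= K; picking a nonzero polynomial q in K, all phi^n q are in H^2,
     and the roots of q can be divided out one at a time, so phi is in H^2. *)

Set Implicit Arguments.
Unset Strict Implicit.
Unset Printing Implicit Defensive.

Import Order.TTheory GRing.Theory Num.Theory.
Import numFieldNormedType.Exports.

Local Open Scope classical_set_scope.
Local Open Scope ring_scope.
Local Open Scope complex_scope.

(** All powers of phi are kept in the last step because phi q in H^2 does not by itself make phi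
    analytic: take phi = conj(z) and q = z. The power phi^(2n) is what rules out a pole of phi^n q1
    at the root being divided out.

    When |b| < 1 on a set of positive measure, the classical route would be the boundary uniqueness
    theorem: a nonzero function with spectrum on one side cannot vanish on such a set. Finite
    codimension of K lets polynomials take its place, and for them uniqueness is elementary, since a
    nonzero polynomial has finitely many zeros on the circle.

    The projection and the adjoint are chosen representatives, so operator identities hold only
    almost everywhere. They are obtained by uniqueness of the splitting into a part in H^2 and a
    part orthogonal to it. Membership in either part is read off Fourier coefficients, so everything
    rests on two facts proved from scratch: the characters are complete, and square-summable
    coefficients belong to a function. *)

Section complex_numbers.
Context {R : realType}.
Implicit Types x y z : R[i].

Lemma cReD x y : complex.Re (x + y) = complex.Re x + complex.Re y.
Proof. by case: x y => [a b] [c d]. Qed.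

Lemma cImD x y : complex.Im (x + y) = complex.Im x + complex.Im y.
Proof. by case: x y => [a b] [c d]. Qed.

Lemma cReM x y :
  complex.Re (x * y) = complex.Re x * complex.Re y - complex.Im x * complex.Im y.
Proof. by case: x y => [a b] [c d]. Qed.

Lemma cImM x y :
  complex.Im (x * y) = complex.Re x * complex.Im y + complex.Im x * complex.Re y.
Proof. by case: x y => [a b] [c d]. Qed.

Lemma cReJ x : complex.Re (conjc x) = complex.Re x.
Proof. by case: x. Qed.

Lemma cImJ x : complex.Im (conjc x) = - complex.Im x.
Proof. by case: x. Qed.

(** Real valued and free of square roots, so that pointwise estimates are polynomial inequalities in
    the coordinates. *)
Definition nsq x : R := complex.Re x ^+ 2 + complex.Im x ^+ 2.

Lemma nsq_ge0 x : 0 <= nsq x.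
Proof. by rewrite addr_ge0 ?sqr_ge0. Qed.

Lemma nsqM x y : nsq (x * y) = nsq x * nsq y.
Proof. by rewrite /nsq cReM cImM; ring. Qed.

Lemma nsqJ x : nsq (conjc x) = nsq x.
Proof. by rewrite /nsq cReJ cImJ sqrrN. Qed.

Lemma nsqN x : nsq (- x) = nsq x.
Proof. by rewrite /nsq !raddfN /= !sqrrN. Qed.

Lemma nsqX x n : nsq (x ^+ n) = nsq x ^+ n.
Proof.
by elim: n => [|n IH]; rewrite ?exprS ?nsqM ?IH // /nsq /= expr1n expr0n addr0.
Qed.

Lemma nsqD_le x y : nsq (x + y) <= 2 * nsq x + 2 * nsq y.
Proof.
have := sqr_ge0 (complex.Re x - complex.Re y).
have := sqr_ge0 (complex.Im x - complex.Im y).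
by rewrite /nsq cReD cImD; nra.
Qed.

Lemma nsq_eq0 x : nsq x = 0 -> x = 0.
Proof.
case: x => a b /eqP; rewrite /nsq /= paddr_eq0 ?sqr_ge0 // !sqrf_eq0.
by move=> /andP[/eqP-> /eqP->].
Qed.

Lemma mulcJE x : x * conjc x = (nsq x)%:C.
Proof.
case: x => a b; apply/eqP; rewrite eq_complex /nsq /= mulrN opprK addrC.
by apply/andP; split; apply/eqP; ring.
Qed.

Lemma normc_nsq x : Normc.normc x = Num.sqrt (nsq x).
Proof. by case: x. Qed.

Lemma normc_sqr x : Normc.normc x ^+ 2 = nsq x.
Proof. by rewrite normc_nsq sqr_sqrtr // nsq_ge0. Qed.

End complex_numbers.

(** * Almost everywhere equality, complex integrals and pointwise forms of the norms *)

Section integration.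
Context {R : realType}.
Implicit Types f g h : R -> R[i].
Local Notation mu := (circle_prob R).

Lemma aeS (P Q : R -> Prop) : (\forall t \ae mu, P t) ->
  (forall t, P t -> Q t) -> \forall t \ae mu, Q t.
Proof.
by move=> aP PQ; apply: (@filterS _ _ (ae_filter_ringOfSetsType mu) _ _ PQ aP).
Qed.

Lemma aeS2 (P Q S : R -> Prop) : (\forall t \ae mu, P t) ->
  (\forall t \ae mu, Q t) ->
  (forall t, P t -> Q t -> S t) -> \forall t \ae mu, S t.
Proof.
by move=> aP aQ PQ; apply: (@filterS2 _ _ (ae_filter_ringOfSetsType mu) _ _ _ PQ aP aQ).
Qed.

Lemma aeI (P Q : R -> Prop) : (\forall t \ae mu, P t) ->
  (\forall t \ae mu, Q t) -> \forall t \ae mu, P t /\ Q t.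
Proof. by move=> aP aQ; apply: (aeS2 aP aQ). Qed.

(** The relation [%[ae _]] without its premise [setT t]; see [aeqE]. *)
Definition aeq f g : Prop := \forall t \ae mu, f t = g t.

Lemma aeqE f g : aeq f g <-> f = g %[ae mu].
Proof.
by split=> fg; apply: (aeS fg) => t; [move=> -> | apply].
Qed.

Lemma aeq_refl f : aeq f f.
Proof. exact: aeW. Qed.

Lemma aeq_sym f g : aeq f g -> aeq g f.
Proof. by move=> fg; apply: (aeS fg) => t ->. Qed.

Definition cmeas f : Prop :=
  measurable_fun setT (fun t : measurableTypeR R => complex.Re (f t)) /\
  measurable_fun setT (fun t : measurableTypeR R => complex.Im (f t)).

Lemma cmeasD f g : cmeas f -> cmeas g -> cmeas (fun t => f t + g t).
Proof.
move=> [f1 f2] [g1 g2]; split.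
- by under eq_fun do rewrite cReD; exact: measurable_funD.
- by under eq_fun do rewrite cImD; exact: measurable_funD.
Qed.

Lemma cmeasM f g : cmeas f -> cmeas g -> cmeas (fun t => f t * g t).
Proof.
move=> [f1 f2] [g1 g2]; split.
- by under eq_fun do rewrite cReM;
  exact: (measurable_funB (measurable_funM f1 g1) (measurable_funM f2 g2)).
- by under eq_fun do rewrite cImM;
  exact: (measurable_funD (measurable_funM f1 g2) (measurable_funM f2 g1)).
Qed.

Lemma cmeas_cst c : cmeas (fun=> c).
Proof. by split; exact: measurable_cst. Qed.

Lemma cmeasJ f : cmeas f -> cmeas (fun t => conjc (f t)).
Proof.
move=> [f1 f2]; split.
- by under eq_fun do rewrite cReJ; exact: f1.
- by under eq_fun do rewrite cImJ; exact: (measurableT_comp (@oppr_measurable R setT) f2).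
Qed.

Lemma cmeas_nsq f : cmeas f ->
  measurable_fun setT (fun t : measurableTypeR R => nsq (f t)).
Proof.
by move=> [f1 f2]; apply: measurable_funD; apply: measurable_funX.
Qed.

Definition cint f : Prop :=
  mu.-integrable setT (fun t => (complex.Re (f t))%:E) /\
  mu.-integrable setT (fun t => (complex.Im (f t))%:E).

Lemma integral_circleD f g : cint f -> cint g ->
  integral_circle (fun t => f t + g t) = integral_circle f + integral_circle g.
Proof.
move=> [f1 f2] [g1 g2]; rewrite /integral_circle; apply/eqP; rewrite eq_complex /=.
under eq_Rintegral do rewrite cReD.
rewrite (RintegralD measurableT f1 g1) eqxx /=.
under eq_Rintegral do rewrite cImD.
by rewrite (RintegralD measurableT f2 g2).
Qed.

Lemma integral_circleZ c f : cint f ->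
  integral_circle (fun t => c * f t) = c * integral_circle f.
Proof.
move=> [f1 f2]; rewrite /integral_circle; apply/eqP; rewrite eq_complex.
rewrite cReM cImM /=.
have Z k (F : R -> R) : mu.-integrable setT (fun t => (F t)%:E) ->
    mu.-integrable setT (fun t => (k * F t)%:E).
  by move=> iF; apply: (integrableZl measurableT k iF).
under eq_Rintegral do rewrite cReM.
rewrite (RintegralB measurableT (Z _ _ f1) (Z _ _ f2)).
rewrite (RintegralZl _ measurableT f1) (RintegralZl _ measurableT f2) eqxx /=.
under eq_Rintegral do rewrite cImM.
rewrite (RintegralD measurableT (Z _ _ f2) (Z _ _ f1)).
by rewrite (RintegralZl _ measurableT f1) (RintegralZl _ measurableT f2).
Qed.

Lemma integral_circleJ f : cint f ->
  integral_circle (fun t => conjc (f t)) = conjc (integral_circle f).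
Proof.
move=> [f1 f2]; rewrite /integral_circle; apply/eqP; rewrite eq_complex /=.
under eq_Rintegral do rewrite cReJ.
rewrite eqxx /=.
under eq_Rintegral do rewrite cImJ -mulN1r.
by rewrite (RintegralZl _ measurableT f2) mulN1r.
Qed.

Lemma Rintegral_ae (F G : R -> R) : measurable_fun setT (F : measurableTypeR R -> R) ->
  measurable_fun setT (G : measurableTypeR R -> R) ->
  (\forall t \ae mu, F t = G t) -> \int[mu]_t F t = \int[mu]_t G t.
Proof.
move=> mF mG FG; rewrite /Rintegral; congr fine.
apply: ae_eq_integral => //; [exact/measurable_EFinP..|].
by apply: (aeS FG) => t ->.
Qed.

Lemma integral_circle_ae f g : cmeas f -> cmeas g -> aeq f g ->
  integral_circle f = integral_circle g.
Proof.
move=> [f1 f2] [g1 g2] fg; rewrite /integral_circle; congr (_ +i* _);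
  by apply: Rintegral_ae => //; apply: (aeS fg) => t ->.
Qed.

Lemma integral_circle0 : integral_circle (fun=> 0 : R[i]) = 0.
Proof.
rewrite /integral_circle /= !Rintegral_cst // !mul0r.
by apply/eqP; rewrite eq_complex /= !eqxx.
Qed.

Lemma ae_le_integrable (F G : R -> R) :
  measurable_fun setT (F : measurableTypeR R -> R) ->
  mu.-integrable setT (fun t => (G t)%:E) ->
  (\forall t \ae mu, `|F t| <= G t) -> mu.-integrable setT (fun t => (F t)%:E).
Proof.
move=> mF iG FG; apply/integrableP; split; first exact/measurable_EFinP.
have /integrableP[mG] := iG; apply: le_lt_trans.
apply: ae_ge0_le_integral => //.
- by apply/measurable_EFinP; exact: measurableT_comp.
- exact: measurableT_comp.
- by apply: (aeS FG) => t FGt _; rewrite /= lee_fin (le_trans FGt) // ler_norm.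
Qed.

Lemma L2P f : Lp 2%:E f <->
  cmeas f /\ mu.-integrable setT (fun t => (nsq (f t))%:E).
Proof.
have E t : `|Normc.normc (f t)| `^ 2 = nsq (f t).
  rewrite powR_mulrn // -normrX normc_sqr ger0_norm //.
  exact: nsq_ge0.
have E2 : (\int[mu]_t `|(nsq (f t))%:E| = \int[mu]_t (nsq (f t))%:E)%E.
  by apply: eq_integral => t _; rewrite gee0_abs // lee_fin nsq_ge0.
have E3 : normLp 2%:E f = ((\int[mu]_t (nsq (f t))%:E) `^ 2^-1)%E.
  rewrite /normLp unlock; congr (_ `^ _)%E.
  by apply: eq_integral => t _; rewrite /= E.
split=> [[m1 m2 fin]|[[m1 m2] /integrableP[_ fin]]].
  have cf : cmeas f by split.
  split=> //; apply/integrableP; split.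
    by apply/measurable_EFinP; have := cmeas_nsq cf; exact.
  by rewrite E2 (@lty_poweRy _ _ 2^-1) // -E3.
by split => //; rewrite E3 poweR_lty // -E2.
Qed.

Lemma normLpyP f (M : R) : 0 <= M ->
  (normLp +oo f <= M%:E)%E <-> \forall t \ae mu, Normc.normc (f t) <= M.
Proof.
(* The norm at infinity is an essential supremum only when the whole space has positive measure;
   here its measure is 1. *)
move=> M0; rewrite /normLp unlock ifT; last first.
  by rewrite (_ : _ setT = 1%E) ?lte01 //; exact: (probability_setT mu).
have N0 t : 0 <= Normc.normc (f t) by rewrite normc_nsq sqrtr_ge0.
split=> [/ess_supP H|H]; last apply/ess_supP.
  by apply: (aeS H) => t; rewrite /= lee_fin ger0_norm.
by apply: (aeS H) => t; rewrite /= lee_fin ger0_norm.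
Qed.

Lemma LinfP f : Lp +oo%E f <->
  cmeas f /\ exists2 M, 0 <= M & \forall t \ae mu, nsq (f t) <= M ^+ 2.
Proof.
have B (M : R) t : 0 <= M -> (Normc.normc (f t) <= M) = (nsq (f t) <= M ^+ 2).
  move=> M0; rewrite -normc_sqr ler_sqr ?nnegrE //.
  by rewrite normc_nsq sqrtr_ge0.
split=> [[m1 m2 fin]|[[m1 m2] [M M0 H]]].
  split; first by split.
  exists (Num.max 0 (fine (normLp +oo f))); first by rewrite le_max lexx.
  have M0 : 0 <= Num.max 0 (fine (normLp +oo f)) by rewrite le_max lexx.
  have /normLpyP : (normLp +oo f <= (Num.max 0 (fine (normLp +oo f)))%:E)%E.
    have N0 : (0 <= normLp +oo f)%E by exact: Lnorm_ge0.
    by rewrite -(fineK (_ : normLp +oo f \is a fin_num)) ?ge0_fin_numE //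
      lee_fin /= le_max lexx orbT.
  by move=> /(_ M0) H; apply: (aeS H) => t; rewrite B.
split => //; apply: (@le_lt_trans _ _ M%:E); last exact: ltry.
by apply/normLpyP => //; apply: (aeS H) => t; rewrite B.
Qed.

End integration.

(** * Square-integrable functions, bounded multipliers and the inner product *)

Section L2_space.
Context {R : realType}.
Implicit Types (f g h m : R -> R[i]) (c : R[i]).
Local Notation mu := (circle_prob R).
Local Notation L2 := (Lp 2%:E).
Local Notation Linf := (Lp +oo%E).

Lemma L2_cmeas f : L2 f -> cmeas f.
Proof. by case/L2P. Qed.

Lemma Linf_cmeas f : Linf f -> cmeas f.
Proof. by case/LinfP. Qed.

Lemma L2_le f (G : R -> R) : cmeas f ->
  mu.-integrable setT (fun t => (G t)%:E) ->
  (\forall t \ae mu, nsq (f t) <= G t) -> L2 f.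
Proof.
move=> mf iG fG; apply/L2P; split => //; apply: ae_le_integrable iG _.
  exact: cmeas_nsq.
by apply: (aeS fG) => t; rewrite ger0_norm ?nsq_ge0.
Qed.

Lemma integrableZ_EFin (k : R) (F : R -> R) : mu.-integrable setT (fun t => (F t)%:E) ->
  mu.-integrable setT (fun t => (k * F t)%:E).
Proof. by move=> iF; apply: (integrableZl measurableT k iF). Qed.

Lemma integrableD_EFin (F G : R -> R) : mu.-integrable setT (fun t => (F t)%:E) ->
  mu.-integrable setT (fun t => (G t)%:E) ->
  mu.-integrable setT (fun t => (F t + G t)%:E).
Proof. by move=> iF iG; apply: (integrableD measurableT iF iG). Qed.

Lemma L2D f g : L2 f -> L2 g -> L2 (fun t => f t + g t).
Proof.
move=> /L2P[mf fi] /L2P[mg gi].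
apply: (L2_le (cmeasD mf mg)
  (integrableD_EFin (integrableZ_EFin 2 fi) (integrableZ_EFin 2 gi))).
by apply: aeW => t; exact: nsqD_le.
Qed.

Lemma Linf_mulL2 m f : Linf m -> L2 f -> L2 (fun t => m t * f t).
Proof.
move=> /LinfP[mm [M M0 H]] /L2P[mf fi].
apply: (L2_le (cmeasM mm mf) (integrableZ_EFin (M ^+ 2) fi)).
by apply: (aeS H) => t H'; rewrite nsqM ler_wpM2r ?nsq_ge0.
Qed.

Lemma Linf_cst c : Linf (fun=> c).
Proof.
apply/LinfP; split; first exact: cmeas_cst.
exists (Num.sqrt (nsq c)); first exact: sqrtr_ge0.
by apply: aeW => t; rewrite sqr_sqrtr ?nsq_ge0.
Qed.

Lemma L2_cst c : L2 (fun=> c).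
Proof.
apply: (@L2_le _ (fun=> nsq c)); first exact: cmeas_cst.
  exact: finite_measure_integrable_cst.
exact: aeW.
Qed.

Lemma Linf_L2 f : Linf f -> L2 f.
Proof.
move=> fi; have := Linf_mulL2 fi (L2_cst 1).
by rewrite (_ : (fun t => _) = f) //; apply/funext => t; rewrite mulr1.
Qed.

Lemma L2Z c f : L2 f -> L2 (fun t => c * f t).
Proof. exact/Linf_mulL2/Linf_cst. Qed.

Lemma L2N f : L2 f -> L2 (fun t => - f t).
Proof.
by move=> /(L2Z (-1)); under eq_fun do rewrite mulN1r.
Qed.

Lemma L2B f g : L2 f -> L2 g -> L2 (fun t => f t - g t).
Proof. by move=> fi /L2N; exact: L2D. Qed.

Lemma LinfM f g : Linf f -> Linf g -> Linf (fun t => f t * g t).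
Proof.
move=> /LinfP[mf [M M0 HM]] /LinfP[mg [N N0 HN]]; apply/LinfP.
split; first exact: cmeasM.
exists (M * N); first exact: mulr_ge0.
apply: (aeS2 HM HN) => t h1 h2; rewrite nsqM exprMn.
by apply: ler_pM => //; exact: nsq_ge0.
Qed.

Lemma LinfD f g : Linf f -> Linf g -> Linf (fun t => f t + g t).
Proof.
move=> /LinfP[mf [M M0 HM]] /LinfP[mg [N N0 HN]]; apply/LinfP.
split; first exact: cmeasD.
exists (2 * (M + N)); first by rewrite mulr_ge0 ?addr_ge0.
apply: (aeS2 HM HN) => t h1 h2; apply: (le_trans (nsqD_le _ _)).
by nra.
Qed.

Lemma LinfJ f : Linf f -> Linf (fun t => conjc (f t)).
Proof.
move=> /LinfP[mf [M M0 H]]; apply/LinfP; split; first exact: cmeasJ.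
by exists M => //; apply: (aeS H) => t; rewrite nsqJ.
Qed.

Lemma LinfX f n : Linf f -> Linf (fun t => f t ^+ n).
Proof.
move=> fi; elim: n => [|n IH]; first exact: Linf_cst.
by under eq_fun do rewrite exprS; exact: LinfM.
Qed.

Lemma L2_cint f g : L2 f -> L2 g -> cint (fun t => f t * conjc (g t)).
Proof.
move=> /L2P[mf fi] /L2P[mg gi].
have [m1 m2] := cmeasM mf (cmeasJ mg).
have iG := integrableD_EFin fi gi.
(* Bounds both coordinates of f conj(g) by |f|^2 + |g|^2. The imaginary part takes this shape after
   negating Im f and swapping the coordinates of conj(g). *)
have B (a b c d : R) : `|a * c - b * d| <= (a ^+ 2 + b ^+ 2) + (c ^+ 2 + d ^+ 2).
  rewrite ler_norml; have := sqr_ge0 (a + c); have := sqr_ge0 (a - c).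
  have := sqr_ge0 (b + d); have := sqr_ge0 (b - d).
  have := sqr_ge0 a; have := sqr_ge0 b; have := sqr_ge0 c; have := sqr_ge0 d.
  by move=> *; apply/andP; split; nra.
split; [apply: (ae_le_integrable m1 iG)|apply: (ae_le_integrable m2 iG)];
  apply: aeW => t.
  by rewrite -(nsqJ (g t)) cReM; exact: B.
have H := B (complex.Re (f t)) (- complex.Im (f t)) (complex.Im (conjc (g t)))
  (complex.Re (conjc (g t))).
rewrite mulNr opprK sqrrN in H.
by rewrite cImM -(nsqJ (g t)) (le_trans H) // /nsq lerD2l addrC.
Qed.

Lemma dotDl f g h : L2 f -> L2 g -> L2 h ->
  dotL2 (fun t => f t + g t) h = dotL2 f h + dotL2 g h.
Proof.
move=> fi gi hi; rewrite /dotL2 -integral_circleD; [|exact: L2_cint..].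
by congr integral_circle; apply/funext => t; rewrite mulrDl.
Qed.

Lemma dotZl c f h : L2 f -> L2 h -> dotL2 (fun t => c * f t) h = c * dotL2 f h.
Proof.
move=> fi hi; rewrite /dotL2 -integral_circleZ; last exact: L2_cint.
by congr integral_circle; apply/funext => t; rewrite mulrA.
Qed.

Lemma dotC f g : L2 f -> L2 g -> dotL2 g f = conjc (dotL2 f g).
Proof.
move=> fi gi; rewrite /dotL2 -integral_circleJ; last exact: L2_cint.
by congr integral_circle; apply/funext => t; rewrite rmorphM /= conjcK mulrC.
Qed.

Lemma dotMl m f g :
  dotL2 (fun t => m t * f t) g = dotL2 f (fun t => conjc (m t) * g t).
Proof.
rewrite /dotL2; congr integral_circle; apply/funext => t.
by rewrite rmorphM /= conjcK mulrA (mulrC (f t)).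
Qed.

Lemma dotDr f g h : L2 f -> L2 g -> L2 h ->
  dotL2 h (fun t => f t + g t) = dotL2 h f + dotL2 h g.
Proof.
move=> fi gi hi; rewrite (dotC (L2D fi gi) hi) (dotC fi hi) (dotC gi hi).
by rewrite dotDl // rmorphD.
Qed.

Lemma dotZr c f h : L2 f -> L2 h ->
  dotL2 h (fun t => c * f t) = conjc c * dotL2 h f.
Proof.
move=> fi hi; rewrite (dotC (L2Z c fi) hi) (dotC fi hi).
by rewrite dotZl // rmorphM.
Qed.

Lemma dotBl f g h : L2 f -> L2 g -> L2 h ->
  dotL2 (fun t => f t - g t) h = dotL2 f h - dotL2 g h.
Proof.
move=> fi gi hi; have := dotDl fi (L2Z (-1) gi) hi; rewrite dotZl // mulN1r => <-.
by congr dotL2; apply/funext => t; rewrite mulN1r.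
Qed.

Lemma dotBr f g h : L2 f -> L2 g -> L2 h ->
  dotL2 h (fun t => f t - g t) = dotL2 h f - dotL2 h g.
Proof.
move=> fi gi hi; rewrite (dotC (L2B fi gi) hi) (dotC fi hi) (dotC gi hi).
by rewrite dotBl // rmorphB.
Qed.

Lemma dot0l h : dotL2 (fun=> 0) h = 0.
Proof.
rewrite /dotL2; under eq_fun do rewrite mul0r; exact: integral_circle0.
Qed.

Lemma dot0r h : dotL2 h (fun=> 0) = 0.
Proof.
rewrite /dotL2; under eq_fun do rewrite conjc0 mulr0; exact: integral_circle0.
Qed.

Lemma dot_ae f f' g g' : L2 f -> L2 f' -> L2 g -> L2 g' ->
  aeq f f' -> aeq g g' -> dotL2 f g = dotL2 f' g'.
Proof.
move=> fi fi' gi gi' ff gg; apply: integral_circle_ae.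
- by apply: cmeasM; [|apply: cmeasJ]; exact: L2_cmeas.
- by apply: cmeasM; [|apply: cmeasJ]; exact: L2_cmeas.
- by apply: (aeS2 ff gg) => t -> ->.
Qed.

(** The square of the L^2 norm, not the norm itself. *)
Definition nrm f : R := \int[mu]_t nsq (f t).

Lemma nrm_ge0 f : 0 <= nrm f.
Proof. by apply: Rintegral_ge0 => t _; exact: nsq_ge0. Qed.

Lemma dotff f : dotL2 f f = (nrm f)%:C.
Proof.
rewrite /dotL2 /integral_circle /nrm.
under eq_Rintegral do rewrite mulcJE /=.
under [X in _ +i* X]eq_Rintegral do rewrite mulcJE /=.
by rewrite Rintegral_cst // mul0r.
Qed.

Lemma nrmDZ f g c : L2 f -> L2 g -> nrm (fun t => f t + c * g t) =
  nrm f + nsq c * nrm g + 2 * complex.Re (conjc c * dotL2 f g).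
Proof.
move=> fi gi; apply: complexI; have gc := L2Z c gi.
rewrite -dotff dotDl ?dotDr ?dotZl ?dotZr ?dotff //; [|exact: L2D..].
rewrite (dotC fi gi).
move: (dotL2 f g) (nrm f) (nrm g) => [x y] p q; case: c gc => a b _.
by apply/eqP; rewrite eq_complex /nsq /=; apply/andP; split; apply/eqP; ring.
Qed.

Lemma pythagoras f g : L2 f -> L2 g -> dotL2 f g = 0 ->
  nrm (fun t => f t + g t) = nrm f + nrm g.
Proof.
move=> fi gi fg; have := nrmDZ 1 fi gi; rewrite fg mulr0 /= mulr0 addr0.
rewrite {1}/nsq /= expr1n expr0n addr0 mul1r => <-.
by congr nrm; apply/funext => t; rewrite mul1r.
Qed.

Lemma dot_CS f g : L2 f -> L2 g -> nsq (dotL2 f g) <= nrm f * nrm g.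
Proof.
move=> fi gi; set d := dotL2 f g.
(* Expansion of the squared norm of f - s d g for real s. The best choice is s = 1 / [nrm g]. If
   [nrm g] is 0, the expression is affine in s, and s = ([nrm f] + 1) / |d|^2 would make it negative
   unless d = 0. *)
have key (s : R) : 0 <= nrm f + s ^+ 2 * nsq d * nrm g - 2 * s * nsq d.
  have := nrm_ge0 (fun t => f t + (- s%:C * d) * g t); rewrite nrmDZ // -/d.
  have -> : nsq (- s%:C * d) = s ^+ 2 * nsq d.
    by rewrite nsqM nsqN {1}/nsq /= expr0n addr0.
  have -> : complex.Re (conjc (- s%:C * d) * d) = - s * nsq d.
    by case: (d) => a b; rewrite /nsq /=; ring.
  by move=> H; apply: (le_trans H); rewrite le_eqVlt; apply/orP; left; apply/eqP; ring.
have := nrm_ge0 f; have := nrm_ge0 g; have := nsq_ge0 d.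
move: (nrm f) (nrm g) (nsq d) key => p q x key x0 q0 p0.
move: q0; rewrite le_eqVlt => /orP[/eqP q0|q0]; last first.
  rewrite -subr_ge0.
  have -> : p * q - x = q * (p + q^-1 ^+ 2 * x * q - 2 * q^-1 * x).
    by field; rewrite gt_eqF.
  by rewrite mulr_ge0 // ltW.
rewrite -q0 mulr0 leNgt; apply/negP => xgt.
have := key ((p + 1) / x); rewrite -q0 mulr0 addr0.
rewrite mulrA divfK ?gt_eqF //; lra.
Qed.

Lemma nrm_eq0 f : L2 f -> nrm f = 0 -> aeq f (fun=> 0).
Proof.
move=> /L2P[mf fi] f0.
have mn : measurable_fun setT (fun t : measurableTypeR R => (nsq (f t))%:E).
  by apply/measurable_EFinP; have := cmeas_nsq mf; exact.
have /(ae_eq_integral_abs mu measurableT mn) H :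
    (\int[mu]_t `|(nsq (f t))%:E| = 0)%E.
  under eq_integral do rewrite gee0_abs ?lee_fin ?nsq_ge0 //.
  by rewrite -(fineK (integrable_fin_num measurableT fi)) -[fine _]/(nrm f) f0.
by apply: (aeS H) => t /(_ I) /= [] /nsq_eq0.
Qed.

Lemma le_nrm f g : L2 f -> L2 g ->
  (\forall t \ae mu, nsq (f t) <= nsq (g t)) -> nrm f <= nrm g.
Proof.
move=> /L2P[mf fi] /L2P[mg gi] fg; apply: fine_le.
- exact: integrable_fin_num.
- exact: integrable_fin_num.
apply: ae_ge0_le_integral => //.
- by move=> t _; rewrite lee_fin nsq_ge0.
- by case/integrableP: fi.
- by move=> t _; rewrite lee_fin nsq_ge0.
- by case/integrableP: gi.
- by apply: (aeS fg) => t H _; rewrite lee_fin.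
Qed.

Lemma aeq_perp f : L2 f -> dotL2 f f = 0 -> aeq f (fun=> 0).
Proof. by move=> fi; rewrite dotff => -[f0]; exact: nrm_eq0. Qed.

End L2_space.

(** * Characters of the circle and their integrals *)

Section fourier_coefficients.
Context {R : realType}.
Implicit Types (f g h m : R -> R[i]) (c : R[i]).
Local Notation mu := (circle_prob R).
Local Notation L2 := (Lp 2%:E).
Local Notation Linf := (Lp +oo%E).

Definition expz (n : int) : R -> R[i] := fun t => circle_var t ^ n.

Arguments expz n t : simpl never.

Lemma nsq_circle_var (t : R) : nsq (circle_var t) = 1.
Proof. by rewrite /nsq /= cos2Dsin2. Qed.

Lemma circle_var_neq0 (t : R) : circle_var t != 0.
Proof.
apply/eqP => H; have := nsq_circle_var t; rewrite H /nsq /= expr0n addr0.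
by move/eqP; rewrite eq_sym oner_eq0.
Qed.

Lemma circle_varJ (t : R) : conjc (circle_var t) = (circle_var t)^-1.
Proof.
apply: (mulfI (circle_var_neq0 t)).
by rewrite mulcJE nsq_circle_var divff // circle_var_neq0.
Qed.

Lemma expzJ n t : conjc (expz n t) = expz (- n) t.
Proof.
rewrite /expz -exprz_inv -circle_varJ; case: n => n; rewrite /exprz ?fmorphV ?rmorphXn //.
Qed.

Lemma expzD (m n : int) t : expz (m + n) t = expz m t * expz n t.
Proof. by rewrite /expz expfzDr // circle_var_neq0. Qed.

Lemma nsq_expz n t : nsq (expz n t) = 1.
Proof.
have P (k : nat) : nsq (expz k t) = 1.
  by rewrite /expz -exprnP nsqX nsq_circle_var expr1n.
by case: (intP n) => [|k|k]; rewrite ?P // -nsqJ expzJ opprK P.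
Qed.

Lemma expz0 t : expz 0 t = 1. Proof. by []. Qed.

Lemma expznat (k : nat) t : expz k t = cos (k%:R * t) +i* sin (k%:R * t).
Proof.
rewrite /expz -exprnP; elim: k => [|k IH]; first by rewrite mul0r cos0 sin0.
rewrite exprS IH mulrSr mulrDl mul1r addrC cosD sinD /circle_var.
by apply/eqP; rewrite eq_complex /= !eqxx /= addrC.
Qed.

Lemma measurable_cosZ (k : R) :
  measurable_fun setT (fun t : measurableTypeR R => cos (k * t)).
Proof.
apply: measurableT_comp; first exact: (continuous_measurable_fun (@continuous_cos R)).
exact: mulrl_measurable.
Qed.

Lemma measurable_sinZ (k : R) :
  measurable_fun setT (fun t : measurableTypeR R => sin (k * t)).
Proof.
apply: measurableT_comp; first exact: (continuous_measurable_fun (@continuous_sin R)).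
exact: mulrl_measurable.
Qed.

Lemma cmeas_expz n : cmeas (expz n).
Proof.
have P (k : nat) : cmeas (expz k).
  split; under eq_fun do rewrite expznat /=.
    exact: measurable_cosZ.
  exact: measurable_sinZ.
case: (intP n) => [|k|k] //.
have := cmeasJ (P k.+1); congr cmeas; apply/funext => t; exact: expzJ.
Qed.

Lemma Linf_expz n : Linf (expz n).
Proof.
apply/LinfP; split; first exact: cmeas_expz.
by exists 1 => //; apply: aeW => t; rewrite nsq_expz expr1n.
Qed.

Lemma L2_expz n : L2 (expz n).
Proof. exact/Linf_L2/Linf_expz. Qed.

Lemma Rintegral_circle_cst (r : R) : \int[mu]_t r = r.
Proof.
rewrite Rintegral_cst //; have T1 := congr1 fine (probability_setT mu).
by rewrite -[RHS]mulr1; congr (_ * _); exact: T1.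
Qed.

Lemma Rintegral_circle_derive (F G : R -> R) :
  (forall t, `|F t| <= 1) -> continuous F ->
  (forall t : R, is_derive t 1 G (F t)) -> G (pi *+ 2) = G 0 ->
  \int[mu]_t F t = 0.
Proof.
move=> F1 cF dG G0.
have mF : measurable_fun setT (F : measurableTypeR R -> R).
  exact: continuous_measurable_fun.
have iF : mu.-integrable setT (fun t => (F t)%:E).
  apply: (@ae_le_integrable _ F (fun=> 1)) => //.
    exact: finite_measure_integrable_cst.
  exact: aeW.
(* The formula for uniform integrals is for nonnegative functions, so it is applied to F + 1, whose
   antiderivative is G + t; the bound on F serves this shift. *)
have H : (\int[mu]_t (F t + 1)%:E = 1)%E.
  rewrite integral_uniform //; last first.
    by move=> t; rewrite lee_fin -lerBlDr sub0r; have /ler_normlP[] := F1 t; rewrite lerNl.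
    by apply/measurable_EFinP; exact: measurable_funD.
  have dH (t : R) : is_derive t 1 (fun t => G t + t) (F t + 1).
    exact: is_deriveD.
  have cH : continuous (fun t => G t + t).
    move=> t; apply: differentiable_continuous.
    by apply/derivable1_diffP; case: (dH t).
  rewrite (@continuous_FTC2 _ (fun t => F t + 1) (fun t => G t + t)).
  - by rewrite G0 addr0 subr0 -EFinB -EFinM addrAC subrr add0r mulVf // gt_eqF // twopi_gt0.
  - exact: twopi_gt0.
  - apply: continuous_subspaceT => t; apply: cvgD; [exact: cF|exact: cvg_cst].
  - split; [by move=> t _; case: (dH t)|apply: cvg_at_right_filter; exact: cH
      |apply: cvg_at_left_filter; exact: cH].
  - by move=> t _; rewrite derive1E; apply: derive_val.
have i1 : mu.-integrable setT (fun=> (1 : R)%:E).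
  exact: finite_measure_integrable_cst.
have := RintegralD measurableT iF i1.
rewrite [X in X = _ -> _]/Rintegral H Rintegral_circle_cst.
by move=> /= E; lra.
Qed.

Lemma integral_expz n : integral_circle (expz n) = (n == 0)%:R.
Proof.
have P (k : nat) : integral_circle (expz k.+1) = 0.
  have k0 : (k.+1%:R : R) != 0 by rewrite pnatr_eq0.
  have p2 : k.+1%:R * (pi *+ 2) = 0 + (pi *+ 2) *+ k.+1 :> R.
    by rewrite add0r mulr_natl.
  rewrite /integral_circle; apply/eqP; rewrite eq_complex /=; apply/andP; split.
    under eq_Rintegral do rewrite expznat /=.
    apply/eqP/(Rintegral_circle_derive (G := fun t => k.+1%:R^-1 * sin (k.+1%:R * t))).
    - by move=> t; exact: cos_max.
    - by move=> t; apply: continuous_comp; [exact: mulrl_continuous|exact: continuous_cos].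
    - move=> t; apply: is_derive_eq.
      by rewrite /GRing.scale /=; move: (k.+1%:R : R) k0 => c c0; field.
    - by rewrite p2 (periodicn (@sinD2pi R)) mulr0.
  under eq_Rintegral do rewrite expznat /=.
  apply/eqP/(Rintegral_circle_derive (G := fun t => - k.+1%:R^-1 * cos (k.+1%:R * t))).
  - by move=> t; exact: sin_max.
  - by move=> t; apply: continuous_comp; [exact: mulrl_continuous|exact: continuous_sin].
  - move=> t; apply: is_derive_eq.
    by rewrite /GRing.scale /=; move: (k.+1%:R : R) k0 => c c0; field.
  - by rewrite p2 (periodicn (@cosD2pi R)) mulr0.
case: (intP n) => [|k|k].
- have -> : expz 0 = (fun=> 1 : R[i]) by [].
  by rewrite /integral_circle eqxx /= !Rintegral_circle_cst.
- by rewrite P.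
- rewrite (_ : expz _ = fun t => conjc (expz k.+1 t)); last first.
    by apply/funext => t; rewrite expzJ.
  rewrite integral_circleJ ?P ?conjc0 //.
  have := L2_cint (L2_expz k.+1) (L2_cst 1).
  by under eq_fun do rewrite rmorph1 mulr1.
Qed.

End fourier_coefficients.

Arguments expz R n t : simpl never.

(** * Multipliers that preserve the vanishing of all Fourier coefficients *)

Section completeness.
Context {R : realType}.
Implicit Types (f g h : R -> R[i]) (c : R[i]) (n : int).
Local Notation mu := (circle_prob R).
Local Notation L2 := (Lp 2%:E).
Local Notation Linf := (Lp +oo%E).
Local Notation coef := fourier_coef.

Lemma fcoefD f g n : L2 f -> L2 g ->
  coef (fun t => f t + g t) n = coef f n + coef g n.
Proof. by move=> fi gi; apply: dotDl => //; exact: L2_expz. Qed.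

Lemma fcoefB f g n : L2 f -> L2 g ->
  coef (fun t => f t - g t) n = coef f n - coef g n.
Proof. by move=> fi gi; apply: dotBl => //; exact: L2_expz. Qed.

Lemma fcoefZ c f n : L2 f -> coef (fun t => c * f t) n = c * coef f n.
Proof. by move=> fi; apply: dotZl => //; exact: L2_expz. Qed.

Lemma fcoef_ae f g n : L2 f -> L2 g -> aeq f g -> coef f n = coef g n.
Proof.
move=> fi gi fg; apply: dot_ae => //; [exact: L2_expz..|exact: aeq_refl].
Qed.

Lemma fcoef_shift f (m n : int) :
  coef (fun t => expz m t * f t) n = coef f (n - m).
Proof.
rewrite /fourier_coef dotMl; congr dotL2; apply/funext => t.
by rewrite expzJ -[_ ^ n]/(expz n t) -expzD addrC.
Qed.

Lemma fcoefJ f n : L2 f -> coef (fun t => conjc (f t)) n = conjc (coef f (- n)).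
Proof.
move=> fi; rewrite /fourier_coef /dotL2 -integral_circleJ; last first.
  exact: (L2_cint fi (L2_expz (- n))).
congr integral_circle; apply/funext => t; rewrite rmorphM /=.
by congr (_ * conjc _); rewrite -[RHS]/(conjc (expz (- n) t)) expzJ opprK.
Qed.

Lemma fcoef_expz (m n : int) : coef (expz m : R -> R[i]) n = (m == n)%:R.
Proof.
rewrite -subr_eq0 -(@integral_expz R) /fourier_coef /dotL2.
by congr integral_circle; apply/funext => t; rewrite -[_ ^ n]/(expz n t) expzJ expzD.
Qed.

Lemma nrm_expz n : nrm (expz n : R -> R[i]) = 1.
Proof. by rewrite /nrm; under eq_Rintegral do rewrite nsq_expz; exact: Rintegral_circle_cst. Qed.

Lemma fcoef_le_nrm f n : L2 f -> nsq (coef f n) <= nrm f.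
Proof.
by move=> fi; have := dot_CS fi (L2_expz n); rewrite nrm_expz mulr1.
Qed.

Lemma fcoef_cst c n : coef (fun=> c) n = if n == 0 then c else 0.
Proof.
have := fcoefZ c n (L2_expz 0); rewrite fcoef_expz eq_sym.
rewrite (_ : (fun t => _) = fun=> c); last by apply/funext => t; rewrite expz0 mulr1.
by move=> ->; case: eqP; rewrite ?mulr1 ?mulr0.
Qed.

Definition fcoef_null f := L2 f /\ forall n, coef f n = 0.

(* The indicators among these multipliers turn out to form a sigma-algebra containing the
   half-lines, which gives the completeness of the characters. *)
Definition null_multiplier h :=
  Linf h /\ forall f, fcoef_null f -> fcoef_null (fun t => h t * f t).

Lemma null_multiplierD h k : null_multiplier h -> null_multiplier k ->
  null_multiplier (fun t => h t + k t).
Proof.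
move=> [hi Hh] [ki Hk]; split; first exact: LinfD.
move=> f f0; have [l1 e1] := Hh _ f0; have [l2 e2] := Hk _ f0.
under eq_fun do rewrite mulrDl.
by split=> [|n]; [exact: L2D|rewrite fcoefD // e1 e2 addr0].
Qed.

Lemma null_multiplierM h k : null_multiplier h -> null_multiplier k ->
  null_multiplier (fun t => h t * k t).
Proof.
move=> [hi Hh] [ki Hk]; split; first exact: LinfM.
move=> f f0; under eq_fun do rewrite -mulrA.
exact/Hh/Hk.
Qed.

Lemma null_multiplier_cst c : null_multiplier (fun=> c).
Proof.
split; first exact: Linf_cst.
by move=> f [fi f0]; split=> [|n]; [exact: L2Z|rewrite fcoefZ // f0 mulr0].
Qed.

Lemma null_multiplier_expz n : null_multiplier (expz n).
Proof.
split; first exact: Linf_expz.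
move=> f [fi f0]; split=> [|m]; first exact/Linf_mulL2/fi/Linf_expz.
by rewrite fcoef_shift f0.
Qed.

Lemma null_multiplierX h k : null_multiplier h ->
  null_multiplier (fun t => h t ^+ k).
Proof.
move=> hm; elim: k => [|k IH]; first exact: null_multiplier_cst.
by under eq_fun do rewrite exprS; exact: null_multiplierM.
Qed.

Lemma null_multiplier_ae h k : null_multiplier h -> Linf k -> aeq h k ->
  null_multiplier k.
Proof.
move=> [hi Hh] ki hk; split => // f f0; have [l e] := Hh _ f0.
have fi := f0.1; have kf := Linf_mulL2 ki fi; split => // n.
by rewrite -(e n); apply: fcoef_ae => //; apply: (aeS hk) => t ->.
Qed.

Lemma Linf_real (q : R -> R) :
  measurable_fun setT (q : measurableTypeR R -> R) ->
  (forall t, `|q t| <= 1) -> Linf (fun t => (q t)%:C).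
Proof.
move=> mq q1; apply/LinfP; split; first by split => //=; exact: measurable_cst.
exists 1 => //; apply: aeW => t; rewrite /nsq /= expr0n addr0 expr1n.
by rewrite -real_normK ?num_real // expr_le1.
Qed.

(** The n-th coefficient of p f equals that of (p - q_k) f, hence is bounded by the L^2 norm of (p -
    q_k) f. That norm tends to 0 by dominated convergence with majorant 4 |f|^2. *)
Lemma null_multiplier_lim (q : nat -> R -> R) (p : R -> R) :
  (forall k, measurable_fun setT (q k : measurableTypeR R -> R)) ->
  measurable_fun setT (p : measurableTypeR R -> R) ->
  (forall k t, `|q k t| <= 1) -> (forall t, `|p t| <= 1) ->
  (\forall t \ae mu, (fun k => q k t) @ \oo --> p t) ->
  (forall k, null_multiplier (fun t => (q k t)%:C)) ->
  null_multiplier (fun t => (p t)%:C).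
Proof.
move=> mq mp q1 p1 qp Mq; have pi := Linf_real mp p1; split => // f f0.
have fi := f0.1; have pf := Linf_mulL2 pi fi; split => // n.
have qi k := Linf_real (mq k) (q1 k).
have qf k := Linf_mulL2 (qi k) fi.
pose F k (t : R) := ((q k t - p t) ^+ 2 * nsq (f t))%:E.
have mf : measurable_fun setT (fun t : measurableTypeR R => nsq (f t)).
  by have := cmeas_nsq (L2_cmeas fi); exact.
have [_ _] : [/\ mu.-integrable setT (fun=> 0%:E : \bar R),
    [sequence \int[mu]_t `|F n t - 0|]_n @ \oo --> 0%E &
    [sequence \int[mu]_t F n t]_n @ \oo --> (\int[mu]_t 0)%E]%E.
  apply: (@dominated_convergence _ _ _ mu setT measurableT F _
    (fun t => (4 * nsq (f t))%:E)).
  - move=> k; apply/measurable_EFinP; apply: measurable_funM => //.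
    by apply: measurable_funX; apply: measurable_funB.
  - exact: measurable_cst.
  - apply: (aeS qp) => t qt _; apply: cvg_EFin; first exact: nearW.
    have c1 : (fun k => q k t - p t) @ \oo --> (0 : R).
      by rewrite -(subrr (p t)); apply: cvgB => //; exact: cvg_cst.
    have c3 : (fun=> nsq (f t) : R) @ (\oo : set_system nat) --> nsq (f t).
      exact: cvg_cst.
    have c4 := cvgM (cvgM c1 c1) c3; rewrite !mul0r in c4.
    suff -> : fine \o (fun k => F k t) = (fun k => q k t - p t) \*
      (fun k => q k t - p t) \* (fun=> nsq (f t)) by exact: c4.
    by apply/funext => k; rewrite /= expr2.
  - by apply: integrableZ_EFin; case/L2P: fi.
  - apply: aeW => t k _; rewrite /F abse_EFin lee_fin normrM ger0_norm ?sqr_ge0 //.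
    rewrite (ger0_norm (nsq_ge0 _)) ler_wpM2r ?nsq_ge0 //.
    have /ler_normlP[] := q1 k t; have /ler_normlP[] := p1 t; nra.
rewrite integral0 => Fcvg.
have H k : ((nsq (coef (fun t => (p t)%:C * f t) n))%:E <= \int[mu]_t F k t)%E.
  have e k' := (Mq k').2 _ f0.
  have -> : coef (fun t => (p t)%:C * f t) n =
      coef (fun t => (p t)%:C * f t - (q k t)%:C * f t) n.
    by rewrite fcoefB // (e k).2 subr0.
  apply: (@le_trans _ _ (nrm (fun t => (p t)%:C * f t - (q k t)%:C * f t))%:E)%E.
    by rewrite lee_fin fcoef_le_nrm //; exact: L2B.
  rewrite /nrm /Rintegral fineK; last first.
    by apply: integrable_fin_num => //; have /L2P[] := L2B pf (qf k).
  rewrite le_eqVlt; apply/orP; left; apply/eqP; apply: eq_integral => t _.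
  rewrite /F -mulrBl nsqM -rmorphB /=; congr (_ * _)%:E.
  by rewrite /nsq /= expr0n addr0 -sqrrN opprB.
have := lime_ge (cvgP _ Fcvg) (nearW _ H).
rewrite (cvg_lim _ Fcvg) // => le0.
by apply: nsq_eq0; apply/eqP; rewrite eq_le nsq_ge0 andbT; exact: le0.
Qed.

End completeness.

(** * Polynomials in y converging to 1 for y < 1/2 and to 0 for y > 1/2 *)

Section peaks.
Context {R : realType}.

Lemma bernoulli_ge (a : R) n : 0 <= a -> 1 + n%:R * a <= (1 + a) ^+ n.
Proof.
move=> a0; elim: n => [|n IH]; first by rewrite mul0r addr0.
rewrite exprS -natr1 mulrDl mul1r.
have : 0 <= n%:R * a * a by rewrite !mulr_ge0.
move: (n%:R * a) ((1 + a) ^+ n) IH => p q IH h; nra.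
Qed.

Lemma bernoulli_le (a : R) n : 0 <= a <= 1 -> 1 - n%:R * a <= (1 - a) ^+ n.
Proof.
move=> /andP[a0 a1]; elim: n => [|n IH]; first by rewrite mul0r subr0.
rewrite exprS -natr1 mulrDl mul1r.
have : 0 <= n%:R * a * a by rewrite !mulr_ge0.
move: (n%:R * a) ((1 - a) ^+ n) IH => p q IH h; nra.
Qed.

(** Bernoulli's inequality bounds the sequence below by 1 - 2^n y^n = 1 - (2y)^n. *)
Lemma peak_cvg1 (y : R) : 0 <= y -> y < 2^-1 ->
  (fun n => (1 - y ^+ n) ^+ (2 ^ n)) @ \oo --> (1 : R).
Proof.
move=> y0 y1; have y2 : 0 <= 2 * y < 1 by apply/andP; split; lra.
have yn n : 0 <= y ^+ n <= 1 by rewrite exprn_ge0 //= exprn_ile1 //; lra.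
apply: (squeeze_cvgr (f := fun n => 1 - (2 * y) ^+ n) (h := fun=> 1)).
- apply: nearW => n; apply/andP; split.
    by have := bernoulli_le (2 ^ n) (yn n); rewrite natrX -exprMn.
  by apply: exprn_ile1; have := yn n; lra.
- rewrite -[X in _ --> X]subr0; apply: cvgB; first exact: cvg_cst.
  by apply: cvg_expr; rewrite ger0_norm; lra.
- exact: cvg_cst.
Qed.

(** Multiplied by (1 + y^n)^(2^n), the sequence is at most 1; by Bernoulli this factor is at least
    (2y)^n, so the sequence is at most (2y)^(-n). *)
Lemma peak_cvg0 (y : R) : 2^-1 < y -> y <= 1 ->
  (fun n => (1 - y ^+ n) ^+ (2 ^ n)) @ \oo --> (0 : R).
Proof.
move=> y0 y1; have y2 : 1 < 2 * y by lra.
have yn n : 0 <= y ^+ n <= 1 by rewrite exprn_ge0 //= ?exprn_ile1 //; lra.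
apply: (squeeze_cvgr (f := fun=> 0) (h := fun n => (2 * y)^-1 ^+ n)).
- apply: nearW => n; apply/andP; split.
    by apply: exprn_ge0; have := yn n; lra.
  have p0 : 0 < (2 * y) ^+ n by apply: exprn_gt0; lra.
  rewrite exprVn -div1r ler_pdivlMr //.
  have /andP[n0 n1] := yn n.
  apply: (@le_trans _ _ ((1 - y ^+ n) ^+ (2 ^ n) * (1 + y ^+ n) ^+ (2 ^ n))).
    apply: ler_wpM2l; first by apply: exprn_ge0; lra.
    have := bernoulli_ge (2 ^ n) n0; rewrite natrX -exprMn; lra.
  by rewrite -exprMn; apply: exprn_ile1; nra.
- exact: cvg_cst.
- apply: cvg_expr; rewrite ger0_norm; last by rewrite invr_ge0; lra.
  by rewrite invf_lt1 //; lra.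
Qed.

End peaks.

(** * Indicators as multipliers, and uniqueness of Fourier coefficients *)

Section uniqueness.
Context {R : realType}.
Implicit Types (f g h : R -> R[i]) (c : R[i]) (n : int).
Local Notation mu := (circle_prob R).
Local Notation L2 := (Lp 2%:E).
Local Notation Linf := (Lp +oo%E).
Local Notation coef := fourier_coef.

(** The point [x] is an optional exceptional angle, such as the end of a half-line; the value 0,
    already outside the open interval, stands for none. *)
Lemma circle_aeW (x : R) (P : R -> Prop) :
  (forall t, 0 < t < pi *+ 2 -> t != x -> P t) -> \forall t \ae mu, P t.
Proof.
move=> H.
have neg1 (y : R) : mu.-negligible [set y].
  apply/negligibleP; first exact: measurable_set1.
  have D := @dominates_uniform_prob R 0 (pi *+ 2) (twopi_gt0 R).
  exact: ((null_content_dominatesP _ _).1 D _ (measurable_set1 y)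
    (lebesgue_measure_set1 y)).
have negC : mu.-negligible (~` `[0, pi *+ 2]%classic).
  apply/negligibleP; first exact: measurableC.
  apply: (etrans (integral_uniform_pdf _ _ _)); rewrite setICl.
  exact: integral_set0.
apply: (negligibleS _ (negligibleU negC (negligibleU (neg1 x)
  (negligibleU (neg1 0) (neg1 (pi *+ 2)))))).
move=> t /= nP; apply: contrapT => /not_orP[/contrapT].
rewrite /= in_itv /= => /andP[t0 t1] /not_orP[/= tx] /not_orP[/= t2 t3].
apply: nP; apply: H; last exact/eqP.
by rewrite !lt_neqAle t0 t1 !andbT; apply/andP; split; apply/eqP => // /esym.
Qed.

Definition null_set_multiplier (A : set R) :=
  measurable (A : set (measurableTypeR R)) /\
  null_multiplier (fun t => (\1_A t)%:C : R[i]).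

Lemma indic_le1 (A : set R) (t : R) : `|\1_A t : R| <= 1.
Proof. by rewrite indicE; case: (_ \in _); rewrite ?normr1 ?normr0. Qed.

Lemma null_set_multiplierC A : null_set_multiplier A ->
  null_set_multiplier (~` A).
Proof.
move=> [mA HA]; split; first exact: measurableC.
have := null_multiplierD (null_multiplier_cst 1)
  (null_multiplierM (null_multiplier_cst (-1)) HA).
congr null_multiplier; apply/funext => t.
by rewrite !indicE in_setC; case: (_ \in _); rewrite /= ?mulr1 ?mulr0 ?subrr ?addr0.
Qed.

Lemma null_set_multiplierI A B : null_set_multiplier A ->
  null_set_multiplier B -> null_set_multiplier (A `&` B).
Proof.
move=> [mA HA] [mB HB]; split; first exact: measurableI.
have := null_multiplierM HA HB.
congr null_multiplier; apply/funext => t.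
by rewrite !indicE in_setI; case: (_ \in _); case: (_ \in _);
  rewrite /= ?mulr1 ?mulr0 ?mul0r.
Qed.

Lemma null_set_multiplier0 : null_set_multiplier set0.
Proof.
split; first exact: measurable0.
have := null_multiplier_cst (0 : R[i]); congr null_multiplier; apply/funext => t.
by rewrite indicE in_set0.
Qed.

Lemma null_set_multiplier_bigcup (F : (set R)^nat) :
  (forall k, null_set_multiplier (F k)) -> null_set_multiplier (\bigcup_k F k).
Proof.
move=> HF; pose G (n : nat) := \bigcup_(i < n) F i.
have HG (n : nat) : null_set_multiplier (G n).
  elim: n => [|n IH]; first by rewrite /G bigcup_mkord big_ord0; exact: null_set_multiplier0.
  rewrite /G bigcup_mkord big_ord_recr /= -bigcup_mkord -/(G n).
  rewrite -[_ `|` _]setCK setCU; apply/null_set_multiplierC/null_set_multiplierI;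
    exact: null_set_multiplierC.
have mU : measurable (\bigcup_k F k : set (measurableTypeR R)).
  by apply: bigcupT_measurable => n; case: (HF n).
split => //.
apply: (@null_multiplier_lim R (fun k t => \1_(G k) t) (fun t => \1_(\bigcup_k F k) t)).
- by move=> k; apply: measurable_indic; case: (HG k).
- exact: measurable_indic.
- by move=> k t; exact: indic_le1.
- exact: indic_le1.
- apply: aeW => t; apply: cvg_near_cst.
  have [[n _ Fn]|nU] := pselect ((\bigcup_k F k) t).
    exists n.+1 => //= k /= nk; rewrite !indicE !mem_set //; first by exists n.
    by exists n.
  apply: nearW => k; rewrite !indicE !memNset // => -[i _ Fi].
  by apply: nU; exists i.
- by move=> k; case: (HG k).
Qed.

Lemma null_multiplier_cos (a : R) :
  null_multiplier (fun t => (cos (t - a))%:C : R[i]).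
Proof.
have := null_multiplierD
  (null_multiplierM (null_multiplier_cst (2^-1 * (cos a -i* sin a))) (null_multiplier_expz 1))
  (null_multiplierM (null_multiplier_cst (2^-1 * (cos a +i* sin a))) (null_multiplier_expz (-1))).
congr null_multiplier; apply/funext => t.
rewrite -[-1%:Z]/(- (1 : int)) -expzJ /expz expr1z /circle_var cosB.
have -> : 2^-1 = (2^-1)%:C :> R[i] by rewrite fmorphV rmorph_nat.
by apply/eqP; rewrite eq_complex /=; apply/andP; split; apply/eqP; field.
Qed.

Lemma null_set_multiplier_itv (x : R) : null_set_multiplier `]x, +oo[%classic.
Proof.
have mx : measurable (`]x, +oo[%classic : set (measurableTypeR R)).
  exact: measurable_itv.
have mi := @measurable_indic _ (measurableTypeR R) R setT _ mx.
split => //; have Li := Linf_real mi (@indic_le1 _).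
have E t : \1_(`]x, +oo[%classic) t = (x < t)%R%:R :> R.
  by rewrite indicE mem_setE in_itv /= andbT.
have [x0|x0] := ltP x 0.
  apply: (null_multiplier_ae (null_multiplier_cst 1)) => //.
  by apply: (circle_aeW (x := 0)) => t /andP[t0 _] _; rewrite E (lt_trans x0 t0).
have [x1|x1] := ltP x (pi *+ 2); last first.
  apply: (null_multiplier_ae (null_multiplier_cst 0)) => //.
  apply: (circle_aeW (x := 0)) => t /andP[_ t1] _.
  by rewrite E ltNge (ltW (lt_le_trans t1 x1)).
(* A trigonometric polynomial with y - 1/2 = sin(t/2) sin((x - t)/2) / 2, so on the circle y < 1/2
   exactly when t > x. The factor 1/4 keeps y in [0, 1], as the peak polynomials require. *)
pose y (t : R) := 2^-1 + 4^-1 * (cos (t - x / 2) - cos (x / 2)).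
have y01 t : 0 <= y t <= 1.
  have := cos_geN1 (t - x / 2); have := cos_le1 (t - x / 2).
  have := cos_geN1 (x / 2); have := cos_le1 (x / 2).
  by rewrite /y => *; apply/andP; split; lra.
have yM : null_multiplier (fun t => (y t)%:C : R[i]).
  have := null_multiplierD (null_multiplier_cst ((2^-1 - 4^-1 * cos (x / 2))%:C))
    (null_multiplierM (null_multiplier_cst (4^-1)%:C) (null_multiplier_cos (x / 2))).
  congr null_multiplier; apply/funext => t; rewrite -rmorphM -rmorphD /=; congr (_%:C).
  by rewrite /y; ring.
have my : measurable_fun setT (y : measurableTypeR R -> R).
  by have [/Linf_cmeas[]] := yM.
pose q (n : nat) t := (1 - y t ^+ n) ^+ (2 ^ n).
apply: (@null_multiplier_lim R q (fun t => \1_(`]x, +oo[%classic) t)) => //.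
- move=> k; apply: measurable_funX; apply: measurable_funB => //.
  exact: measurable_funX.
- move=> k t; have /andP[y0 y1] := y01 t.
  have /andP[z0 z1] : 0 <= y t ^+ k <= 1 by rewrite exprn_ge0 //= exprn_ile1.
  by rewrite ger0_norm ?exprn_ge0 ?exprn_ile1 //; lra.
- exact: indic_le1.
- apply: (circle_aeW (x := x)) => t /andP[t0 t1] tx; rewrite E.
  have /andP[y0 y1] := y01 t.
  have key : y t - 2^-1 = 2^-1 * (sin (t / 2) * sin (x / 2 - t / 2)).
    rewrite /y; have -> : t - x / 2 = t / 2 - (x / 2 - t / 2) by field.
    rewrite (_ : cos (x / 2) = cos (t / 2 + (x / 2 - t / 2))); last by congr cos; field.
    by move: (x / 2 - t / 2) => d; rewrite cosB cosD; field.
  have pi2 : pi *+ 2 = 2 * pi :> R by rewrite mulr_natl.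
  have s0 : 0 < sin (t / 2) by apply: sin_gt0_pi; apply/andP; split; lra.
  move: tx; rewrite neq_lt => /orP[tx|tx].
    rewrite ltNge (ltW tx) /=; apply: peak_cvg0 => //.
    rewrite -subr_gt0 key mulr_gt0 // mulr_gt0 //.
    by apply: sin_gt0_pi; apply/andP; split; lra.
  rewrite tx; apply: peak_cvg1 => //.
  rewrite -subr_lt0 key pmulr_rlt0 // pmulr_rlt0 // -oppr_gt0 -sinN.
  by apply: sin_gt0_pi; apply/andP; split; lra.
- move=> k; have := null_multiplierX (2 ^ k) (null_multiplierD (null_multiplier_cst 1)
    (null_multiplierM (null_multiplier_cst (-1)) (null_multiplierX k yM))).
  congr null_multiplier; apply/funext => t.
  by rewrite /q mulN1r rmorphXn rmorphB rmorph1 rmorphXn.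
Qed.

Lemma null_set_multiplier_measurable (A : set R) :
  measurable (A : set (measurableTypeR R)) -> null_set_multiplier A.
Proof.
rewrite [X in X A -> _](RGenOInfty.measurableE R); apply: smallest_sub.
  split; first exact: null_set_multiplier0.
    by move=> B; rewrite setTD; exact: null_set_multiplierC.
  exact: null_set_multiplier_bigcup.
by move=> _ [x ->]; exact: null_set_multiplier_itv.
Qed.

(** Indicators of measurable sets E are multipliers, and the coefficient of 1_E f at frequency 0 is
    the integral of f over E. Hence all these integrals vanish. *)
Lemma fcoef_null_eq0 f : fcoef_null f -> aeq f (fun=> 0).
Proof.
move=> f0; have fi := f0.1; have [mf1 mf2] := L2_cmeas fi.
have cf : cint f.
  by have := L2_cint fi (L2_cst 1); under eq_fun do rewrite rmorph1 mulr1.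
have I0 (E : set R) : measurable (E : set (measurableTypeR R)) ->
    integral_circle (fun t => (\1_E t)%:C * f t) = 0.
  move=> mE; have [_ [_ /(_ f f0)[_ /(_ 0) <-]]] := null_set_multiplier_measurable mE.
  by rewrite /fourier_coef /dotL2; congr integral_circle; apply/funext => t; rewrite rmorph1 mulr1.
have Rint (F : R -> R) (E : set R) : measurable (E : set (measurableTypeR R)) ->
    mu.-integrable setT (fun t => (F t)%:E) ->
    \int[mu]_t (\1_E t * F t) = 0 -> (\int[mu]_(t in E) (F t)%:E = \int[mu]_(t in E) 0)%E.
  move=> mE iF H0; rewrite integral0 integral_mkcond.
  have iE : mu.-integrable setT (fun t => (\1_E t * F t)%:E).
    apply: (ae_le_integrable _ (integrable_norm iF)).
      by apply: measurable_funM; [exact: measurable_indic|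
        apply/measurable_EFinP; case/integrableP: iF].
    apply: aeW => t; rewrite normrM ler_piMl ?indic_le1 //.
  transitivity (\int[mu]_t (\1_E t * F t)%:E)%E.
    by apply: eq_integral => t _; rewrite patchE indicE; case: ifP; rewrite ?mul1r ?mul0r.
  by rewrite -(fineK (integrable_fin_num measurableT iE)) -[fine _]/(\int[mu]_t (\1_E t * F t)) H0.
have H1 : ae_eq mu setT (fun t => (complex.Re (f t))%:E) (fun=> 0%E).
  apply: integral_ae_eq => //; first exact: cf.1.
  move=> E _ mE; apply: Rint => //; first exact: cf.1.
  apply: (etrans _ (congr1 (@complex.Re _) (I0 E mE))); rewrite /integral_circle /=.
  by apply: eq_Rintegral => t _; rewrite cReM /= mul0r subr0.
have H2 : ae_eq mu setT (fun t => (complex.Im (f t))%:E) (fun=> 0%E).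
  apply: integral_ae_eq => //; first exact: cf.2.
  move=> E _ mE; apply: Rint => //; first exact: cf.2.
  apply: (etrans _ (congr1 (@complex.Im _) (I0 E mE))); rewrite /integral_circle /=.
  by apply: eq_Rintegral => t _; rewrite cImM /= mul0r addr0.
apply: (aeS2 H1 H2) => t /(_ I) [fr] /(_ I) [fi'].
by apply/eqP; rewrite eq_complex fr fi' !eqxx.
Qed.

Lemma fcoef_inj f g : L2 f -> L2 g -> (forall n, coef f n = coef g n) -> aeq f g.
Proof.
move=> fi gi fg; have H : fcoef_null (fun t => f t - g t).
  by split=> [|n]; [exact: L2B|rewrite fcoefB // fg subrr].
by apply: (aeS (fcoef_null_eq0 H)) => t /eqP; rewrite subr_eq0 => /eqP.
Qed.

End uniqueness.

(** * Completeness of L^2 *)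

Section riesz_fischer.
Context {R : realType}.
Implicit Types (f g h : R -> R[i]) (c : R[i]).
Local Notation mu := (circle_prob R).
Local Notation L2 := (Lp 2%:E).
Local Notation Linf := (Lp +oo%E).
Local Notation coef := fourier_coef.

Lemma integral_nsq f : L2 f -> (\int[mu]_t (nsq (f t))%:E = (nrm f)%:E)%E.
Proof.
move=> /L2P[_ fi]; rewrite /nrm /Rintegral fineK //.
exact: integrable_fin_num.
Qed.

Lemma cvg_EFin_seq (s : nat -> R) (l : R) : s @ \oo --> l ->
  (fun k => (s k)%:E) @ \oo --> l%:E.
Proof. by move=> sl; apply: cvg_EFin; [exact: nearW|exact: sl]. Qed.

Lemma nsq_cvg (s : nat -> R[i]) (l c : R[i]) :
  (fun m => complex.Re (s m)) @ \oo --> complex.Re l ->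
  (fun m => complex.Im (s m)) @ \oo --> complex.Im l ->
  (fun m => nsq (s m - c)) @ \oo --> nsq (l - c).
Proof.
have E (x : R[i]) : nsq (x - c) =
    (complex.Re x - complex.Re c) * (complex.Re x - complex.Re c) +
    (complex.Im x - complex.Im c) * (complex.Im x - complex.Im c).
  by rewrite /nsq cReD cImD !raddfN /= !expr2.
move=> sR sI; rewrite E; under eq_fun do rewrite E.
by apply: cvgD; apply: cvgM; apply: cvgB => //; exact: cvg_cst.
Qed.

(** By monotone convergence the sum of the majorants is integrable, hence finite almost
    everywhere. *)
Lemma series_ae_cvg (d : nat -> R -> R) (A : nat -> R -> R) :
  (forall k, measurable_fun setT (A k : measurableTypeR R -> R)) ->
  (forall k t, `|d k t| <= A k t) ->
  (\sum_(k <oo) \int[mu]_t (A k t)%:E < +oo)%E ->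
  \forall t \ae mu, cvgn (series (d^~ t)).
Proof.
move=> mA dA fin.
have A0 k t : 0 <= A k t by apply: le_trans (dA k t).
have mS : measurable_fun setT
    (fun t : measurableTypeR R => \sum_(k <oo) (A k t)%:E)%E.
  by apply: ge0_emeasurable_sum => [k t _ _|k _]; [rewrite lee_fin|apply/measurable_EFinP].
have iS : mu.-integrable setT (fun t => \sum_(k <oo) (A k t)%:E)%E.
  apply/integrableP; split => //.
  under eq_integral => t _.
    rewrite gee0_abs; last by apply: nneseries_ge0 => k _ _; rewrite lee_fin.
    over.
  rewrite integral_nneseries //; first by move=> k; apply/measurable_EFinP.
  by move=> k t _; rewrite lee_fin.
apply: (aeS (integrable_ae measurableT iS)) => t /(_ I) Sfin.
apply: normed_cvg; apply: (@series_le_cvg _ _ (A^~ t)).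
- by move=> k; exact: normr_ge0.
- by move=> k; exact: A0.
- by move=> k; exact: dA.
apply: (@nondecreasing_is_cvgn _ (series (A^~ t))).
  exact: nondecreasing_series.
exists (fine (\sum_(k <oo) (A k t)%:E)%E) => _ [k _ <-].
rewrite -lee_fin fineK // /series /= -sumEFin.
by apply: nneseries_lim_ge => i _; rewrite lee_fin.
Qed.

(** The geometric rate makes u_k converge almost everywhere, without passing to a subsequence;
    Fatou's lemma then carries the rate to the limit. *)
Lemma L2_complete (u : nat -> R -> R[i]) : (forall k, L2 (u k)) ->
  (forall k m, (k <= m)%N -> nrm (fun t => u m t - u k t) <= 4^-1 ^+ k) ->
  exists2 h, L2 h & forall k, nrm (fun t => h t - u k t) <= 4^-1 ^+ k.
Proof.
move=> ui uC; pose D k t := u k.+1 t - u k t.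
have Di k : L2 (D k) by exact: L2B.
(* By the arithmetic-geometric mean inequality this dominates |Re D_k| and |Im D_k|. Its integral is
   at most 2^k 4^(-k) + 2^(-k), which is summable. *)
pose A k t := 2 ^+ k * nsq (D k t) + 2^-1 ^+ k.
have mA k : measurable_fun setT (A k : measurableTypeR R -> R).
  apply: measurable_funD => //; apply: measurable_funM => //.
  by have := cmeas_nsq (L2_cmeas (Di k)); exact.
have AM (k : nat) (x y : R) : `|x| <= 2 ^+ k * (x ^+ 2 + y ^+ 2) + 2^-1 ^+ k.
  have p0 : 0 < 2 ^+ k :> R by exact: exprn_gt0.
  rewrite exprVn; move: (2 ^+ k) p0 => p p0.
  have -> : p * (x ^+ 2 + y ^+ 2) + p^-1 =
      `|x| + p * y ^+ 2 + p^-1 * ((p * `|x| - 2^-1) ^+ 2 + 3 / 4).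
    by rewrite -[x ^+ 2]real_normK ?num_real //; field; rewrite gt_eqF.
  rewrite -addrA lerDl; apply: addr_ge0; apply: mulr_ge0.
  - exact: ltW.
  - exact: sqr_ge0.
  - by rewrite invr_ge0 ltW.
  - by apply: addr_ge0; [exact: sqr_ge0|lra].
have IA k : (\int[mu]_t (A k t)%:E <= (2 * 2^-1 ^+ k)%:E)%E.
  have iN := integrableZ_EFin (2 ^+ k) (proj2 ((L2P _).1 (Di k))).
  have iC : mu.-integrable setT (fun=> (2^-1 ^+ k : R)%:E).
    exact: finite_measure_integrable_cst.
  rewrite -(fineK (integrable_fin_num measurableT (integrableD_EFin iN iC))) lee_fin.
  rewrite -[fine _]/(\int[mu]_t (2 ^+ k * nsq (D k t) + 2^-1 ^+ k)).
  rewrite (RintegralD measurableT iN iC) Rintegral_circle_cst.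
  rewrite (RintegralZl _ measurableT (proj2 ((L2P _).1 (Di k)))) -/(nrm _).
  have := uC k k.+1 (leqnSn k); rewrite -/(D k) => H.
  have p0 : 0 < 2 ^+ k :> R by exact: exprn_gt0.
  have E : 2 ^+ k * 4^-1 ^+ k = 2^-1 ^+ k :> R by rewrite -exprMn; congr (_ ^+ _); field.
  by rewrite mulr_natl mulr2n lerD2r -E ler_wpM2l // ltW.
have fin : (\sum_(k <oo) \int[mu]_t (A k t)%:E < +oo)%E.
  have A0 k t : 0 <= A k t.
    by rewrite addr_ge0 ?mulr_ge0 ?nsq_ge0 ?exprn_ge0 // invr_ge0.
  apply: (@le_lt_trans _ _ (\sum_(k <oo) (2 * 2^-1 ^+ k : R)%:E)%E).
    apply: lee_nneseries => [k _ _|k _]; last exact: IA.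
    by apply: integral_ge0 => t _; rewrite lee_fin.
  have : cvgn (series (geometric (2 : R) 2^-1)).
    by apply: is_cvg_geometric_series; rewrite ger0_norm // invf_lt1 // ltr1n.
  move=> /cvg_ex[l Hl]; rewrite (_ : \sum_(k <oo) _ = l%:E)%E ?ltry //.
  apply/cvg_lim => //; under eq_fun do rewrite sumEFin.
  exact: (cvg_EFin_seq Hl).
have cvgRe := series_ae_cvg (d := fun k t => complex.Re (D k t)) mA (fun k t => AM k _ _) fin.
have cvgIm : \forall t \ae mu, cvgn (series (fun k => complex.Im (D k t))).
  apply: (series_ae_cvg (d := fun k t => complex.Im (D k t)) mA _ fin) => k t.
  by rewrite /A /nsq addrC [X in 2 ^+ k * X]addrC addrC; exact: AM.
have tele (p : R[i] -> R) t : (forall x y, p (x + y) = p x + p y) ->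
    cvgn (series (fun k => p (D k t))) -> cvgn (fun k => p (u k t)).
  move=> pD /cvg_ex[l Hl]; apply/cvg_ex; exists (l + p (u 0%N t)).
  rewrite (_ : (fun k => _) = (fun k => series (fun k => p (D k t)) k + p (u 0%N t))).
    by apply: cvgD => //; exact: cvg_cst.
  apply/funext => k; rewrite /series /=; elim: k => [|k IH].
    by rewrite big_nil add0r.
  rewrite big_nat_recr //= addrAC -IH -pD /D; congr p; ring.
(* An upper limit is measurable without any convergence hypothesis, and equals the limit wherever
   there is one. *)
pose lim_esup (p : R[i] -> R) t : R := fine (limn_esup (fun k => (p (u k t))%:E)).
have mlim p : (forall k, measurable_fun setT (fun t : measurableTypeR R => p (u k t))) ->
    measurable_fun setT (lim_esup p : measurableTypeR R -> R).
  move=> mp; apply: measurableT_comp; first exact: fine_measurable.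
  by apply: measurable_fun_limn_esup => k; apply/measurable_EFinP.
have limP p t : cvgn (fun k => p (u k t)) ->
    (fun k => p (u k t)) @ \oo --> lim_esup p t.
  move=> /cvg_ex[l Hl]; rewrite /lim_esup.
  by rewrite (cvg_limn_einf_sup (cvg_EFin_seq Hl)).2.
pose h t := (lim_esup (@complex.Re R) t) +i* (lim_esup (@complex.Im R) t).
have mh : cmeas h.
  by split => /=; apply: mlim => k; have [] := L2_cmeas (ui k).
have Fatou k : (\int[mu]_t (nsq (h t - u k t))%:E <= (4^-1 ^+ k)%:E)%E.
  have mN f : cmeas f -> measurable_fun setT (fun t : measurableTypeR R => (nsq (f t))%:E).
    by move=> mf; apply/measurable_EFinP; have := cmeas_nsq mf; exact.
  have mB g g' : cmeas g -> cmeas g' -> cmeas (fun t => g t - g' t).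
    move=> mg mg'; have := cmeasD mg (cmeasM (cmeas_cst (-1)) mg').
    by under eq_fun do rewrite mulN1r.
  have mF m : measurable_fun setT (fun t : measurableTypeR R => (nsq (u m t - u k t))%:E).
    by apply: mN; apply: mB; exact: L2_cmeas.
  apply: (@le_trans _ _ (\int[mu]_t limn_einf (fun m => (nsq (u m t - u k t))%:E))%E).
    apply: ae_ge0_le_integral => //.
    - by move=> t _; rewrite lee_fin nsq_ge0.
    - by apply: mN; apply: mB => //; exact: L2_cmeas.
    - move=> t _; rewrite limn_einf_lim; apply: lime_ge; first exact: is_cvg_einfs.
      by apply: nearW => m; apply: le_ereal_inf_tmp => _ [j _ <-]; rewrite lee_fin nsq_ge0.
    - under eq_fun do rewrite limn_einf_lim.
      apply: (emeasurable_fun_cvg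
        (fun n t => einfs (fun m => (nsq (u m t - u k t))%:E) n)).
        by move=> n; apply: (measurable_fun_einfs mF).
      by move=> t _; exact: is_cvg_einfs.
    - apply: (aeS2 cvgRe cvgIm) => t /(tele _ _ (@cReD R)) /limP hRe
        /(tele _ _ (@cImD R)) /limP hIm _.
      suff H : (fun m => nsq (u m t - u k t)) @ \oo --> nsq (h t - u k t).
        by rewrite (cvg_limn_einf_sup (cvg_EFin_seq H)).1.
      exact: nsq_cvg.
  apply: (le_trans (fatou mu measurableT mF _)).
    by move=> m t _; rewrite lee_fin nsq_ge0.
  rewrite limn_einf_lim; apply: lime_le; first exact: is_cvg_einfs.
  (* The lower limit is bounded through the single index max(n, k), because the rate at k concerns
     only indices at least k. *)
  apply: nearW => n; apply: (@le_trans _ _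
    (\int[mu]_t (nsq (u (maxn n k) t - u k t))%:E)%E).
    by apply: ereal_inf_lbound; exists (maxn n k) => //=; exact: leq_maxl.
  by rewrite (integral_nsq (L2B (ui _) (ui _))) lee_fin uC // leq_maxr.
have hi k : L2 (fun t => h t - u k t).
  apply/L2P; split.
    have := cmeasD mh (cmeasM (cmeas_cst (-1)) (L2_cmeas (ui k))).
    by under eq_fun do rewrite mulN1r.
  apply/integrableP; split.
    apply/measurable_EFinP.
    have := cmeasD mh (cmeasM (cmeas_cst (-1)) (L2_cmeas (ui k))).
    under eq_fun do rewrite mulN1r.
    by move=> /cmeas_nsq; exact.
  under eq_integral do rewrite gee0_abs ?lee_fin ?nsq_ge0 //.
  by apply: (le_lt_trans (Fatou k)); exact: ltry.
exists h => [|k]; last by rewrite -lee_fin -integral_nsq.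
have := L2D (hi 0%N) (ui 0%N); congr (Lp _ _).
by apply/funext => t; rewrite subrK.
Qed.

End riesz_fischer.

(** * Partial Fourier sums over a set of frequencies *)

Section partial_sums.
Context {R : realType}.
Implicit Types (f g h : R -> R[i]) (S : pred int).
Local Notation mu := (circle_prob R).
Local Notation L2 := (Lp 2%:E).
Local Notation Linf := (Lp +oo%E).
Local Notation coef := fourier_coef.

(* Frequencies are enumerated by [pickle]; indices outside its range contribute 0. *)
Definition fourier_term f S (i : nat) (t : R) : R[i] :=
  if pickle_inv i is Some n then (if S n then coef f n else 0) * expz n t else 0.

Definition partial_sum f S (N : nat) (t : R) : R[i] :=
  \sum_(i < N) fourier_term f S i t.

Lemma partial_sumS f S N :
  partial_sum f S N.+1 = fun t => partial_sum f S N t + fourier_term f S N t.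
Proof. by apply/funext => t; rewrite /partial_sum big_ord_recr. Qed.

Lemma partial_sum0 f S : partial_sum f S 0 = fun=> 0.
Proof. by apply/funext => t; rewrite /partial_sum big_ord0. Qed.

Lemma L2_fourier_term f S i : L2 (fourier_term f S i).
Proof.
rewrite /fourier_term; case: pickle_inv => [n|]; last exact: L2_cst.
exact/L2Z/L2_expz.
Qed.

Lemma L2_partial_sum f S N : L2 (partial_sum f S N).
Proof.
elim: N => [|N IH]; first by rewrite partial_sum0; exact: L2_cst.
by rewrite partial_sumS; exact/L2D/L2_fourier_term.
Qed.

Lemma fcoef_fourier_term f S (i : nat) (m : int) : coef (fourier_term f S i) m =
  if S m && (pickle m == i) then coef f m else 0.
Proof.
rewrite /fourier_term; case E: (pickle_inv i) => [n|]; last first.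
  rewrite [LHS]dot0l; case: eqP => [H|]; last by rewrite andbF.
  by move: E; rewrite -H pickleK_inv.
have <- : pickle n = i by have := @pickle_invK int i; rewrite E.
rewrite fcoefZ; last exact: L2_expz.
rewrite fcoef_expz (inj_eq (pcan_inj (@pickleK_inv int))) eq_sym.
by case: eqP => [->|]; rewrite ?andbT ?mulr1 ?andbF ?mulr0.
Qed.

Lemma fcoef_partial_sum f S N (m : int) : coef (partial_sum f S N) m =
  if S m && (pickle m < N)%N then coef f m else 0.
Proof.
elim: N => [|N IH]; first by rewrite partial_sum0 andbF [LHS]dot0l.
rewrite partial_sumS fcoefD; [|exact: L2_partial_sum|exact: L2_fourier_term].
rewrite IH fcoef_fourier_term [in RHS]ltnS [in RHS]leq_eqVlt;
  case: (S m) => //=; last by rewrite addr0.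
by case: (ltngtP (pickle m) N) => _ /=; rewrite ?add0r ?addr0.
Qed.

Lemma dot_partial_sum f g S N : L2 g ->
  (forall n, S n -> (pickle n < N)%N -> coef g n = 0) ->
  dotL2 g (partial_sum f S N) = 0.
Proof.
move=> gi; elim: N => [|N IH] g0.
  by rewrite partial_sum0 dot0r.
rewrite partial_sumS dotDr //; [|exact: L2_partial_sum|exact: L2_fourier_term].
rewrite IH ?add0r; last by move=> n Sn nN; apply: g0 => //; exact: ltnW.
rewrite /fourier_term; case E': (pickle_inv N) => [n|]; last first.
  exact: dot0r.
have nN : pickle n = N by have := @pickle_invK int N; rewrite E'.
rewrite dotZr //; last exact: L2_expz.
case Sn : (S n); last by rewrite conjc0 mul0r.
by rewrite -[dotL2 g _]/(coef g n) g0 ?mulr0 // nN.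
Qed.

Lemma nrm_partial_sumB f S N M : (N <= M)%N ->
  nrm (partial_sum f S M) = nrm (partial_sum f S N) +
  nrm (fun t => partial_sum f S M t - partial_sum f S N t).
Proof.
move=> NM; have li := L2_partial_sum f S.
rewrite addrC -pythagoras //; [|exact: L2B|].
  by congr nrm; apply/funext => t; rewrite subrK.
apply: dot_partial_sum; first exact: L2B.
move=> n Sn nN; rewrite fcoefB // !fcoef_partial_sum Sn nN (leq_trans nN NM).
exact: subrr.
Qed.

Lemma bessel f S N : L2 f -> nrm (partial_sum f S N) <= nrm f.
Proof.
move=> fi; have li := L2_partial_sum f S N.
have : nrm f = nrm (fun t => f t - partial_sum f S N t) + nrm (partial_sum f S N).
  rewrite -pythagoras //; [|exact: L2B|].
    by congr nrm; apply/funext => t; rewrite subrK.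
  apply: dot_partial_sum; first exact: L2B.
  by move=> n Sn nN; rewrite fcoefB // fcoef_partial_sum Sn nN subrr.
by move=> ->; rewrite lerDr nrm_ge0.
Qed.

Lemma le_geometric0 (x c z : R) : `|z| < 1 ->
  (forall k : nat, x <= c * z ^+ k) -> x <= 0.
Proof.
move=> z1 H; have G := @cvg_geometric _ c _ z1.
rewrite -(cvg_lim _ G) //; apply: limr_ge; first exact: (cvgP _ G).
exact: nearW.
Qed.

Let norm_quarter : `|4^-1 : R| < 1.
Proof. by rewrite ger0_norm // invf_lt1 // ltr1n. Qed.

(** [S] selects frequencies: the nonnegative ones give the projection onto H^2, the zeros of another
    function's coefficients give orthogonality of disjoint spectra. The squared norms of the partial
    sums increase and are bounded by Bessel, so by Pythagoras the sums form a Cauchy sequence. *)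
Lemma riesz_fischer f S : L2 f -> exists h, [/\ L2 h,
  forall n, coef h n = if S n then coef f n else 0 &
  exists N : nat -> nat, forall k,
    nrm (fun t => h t - partial_sum f S (N k) t) <= 4^-1 ^+ k].
Proof.
move=> fi; have li := L2_partial_sum f S.
pose E N := nrm (partial_sum f S N); pose s := sup (range E).
have hs : has_sup (range E).
  split; first by exists (E 0%N); exists 0%N.
  by exists (nrm f) => _ [N _ <-]; exact: bessel.
have Es N : E N <= s by apply: ub_le_sup; [case: hs|exists N].
have Ele N M : (N <= M)%N -> E N <= E M.
  by move=> NM; rewrite /E (nrm_partial_sumB f S NM) lerDl nrm_ge0.
(* Closeness to the supremum gives the rate required by [L2_complete]; k <= N k makes every
   frequency eventually enter the sums. *)
have /choice[N HN] k : exists N, (k <= N)%N /\ s - 4^-1 ^+ k <= E N.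
  have e0 : 0 < 4^-1 ^+ k :> R by rewrite exprn_gt0 // invr_gt0.
  have [_ [N _ <-] sN] := sup_adherent e0 hs.
  exists (maxn k N); split; first exact: leq_maxl.
  by apply: (le_trans (ltW sN)); apply: Ele; exact: leq_maxr.
have uC k m : (k <= m)%N -> nrm (fun t => partial_sum f S (N m) t -
    partial_sum f S (N k) t) <= 4^-1 ^+ k.
  move=> km; have [_ Hk] := HN k; have [_ Hm] := HN m.
  have km' : 4^-1 ^+ m <= 4^-1 ^+ k :> R.
    by rewrite ler_wiXn2l // ?invr_ge0 // invf_le1 // ler1n.
  have [NN|NN] := leqP (N k) (N m).
    by have := nrm_partial_sumB f S NN; have := Es (N m); rewrite /E in Hk *; lra.
  have := nrm_partial_sumB f S (ltnW NN); have := Es (N k).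
  rewrite (_ : nrm (fun t => partial_sum f S (N k) t - _) =
    nrm (fun t => partial_sum f S (N m) t - partial_sum f S (N k) t)).
    by rewrite /E in Hm *; lra.
  by rewrite /nrm; apply: eq_Rintegral => t _; rewrite -nsqN opprB.
have [h hi hN] := L2_complete (fun k => li (N k)) uC.
exists h; split => //; last by exists N.
move=> n; set c := (X in _ = X).
have H k : nsq (coef h n - c) <= 1 * 4^-1 ^+ k.
  (* At this index frequency n has already been reached, and the error is still at most 4^(-k). *)
  have -> : c = coef (partial_sum f S (N (k + (pickle n).+1)%N)) n.
    rewrite fcoef_partial_sum /c (_ : (pickle n < _)%N) ?andbT //.
    by have [+ _] := HN (k + (pickle n).+1)%N; apply: leq_trans; exact: leq_addl.
  rewrite -fcoefB // mul1r; apply: (le_trans (fcoef_le_nrm _ (L2B hi (li _)))).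
  apply: (le_trans (hN _)).
  by rewrite ler_wiXn2l // ?invr_ge0 ?leq_addr // invf_le1 // ler1n.
apply/eqP; rewrite -subr_eq0; apply/eqP/nsq_eq0/eqP.
by rewrite eq_le nsq_ge0 andbT (le_geometric0 norm_quarter H).
Qed.

(** Up to a null set, g is an L^2 limit of partial sums over frequencies where f has zero
    coefficient, and each of these sums is orthogonal to f. *)
Lemma dot_disjoint f g : L2 f -> L2 g ->
  (forall n, coef f n = 0 \/ coef g n = 0) -> dotL2 f g = 0.
Proof.
move=> fi gi fg; pose S n := coef f n == 0.
have [h [hi hc [N hN]]] := riesz_fischer S gi.
have gh : aeq g h.
  apply: fcoef_inj => // n; rewrite hc /S; case: eqP => // fn.
  by case: (fg n).
rewrite (dot_ae fi fi gi hi (aeq_refl f) gh).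
have H k : nsq (dotL2 f h) <= nrm f * 4^-1 ^+ k.
  have li := L2_partial_sum g S (N k).
  have -> : dotL2 f h = dotL2 f (fun t => h t - partial_sum g S (N k) t).
    rewrite dotBr // dot_partial_sum ?subr0 // => n.
    by rewrite /S => /eqP.
  by apply: (le_trans (dot_CS fi (L2B hi li))); rewrite ler_wpM2l ?nrm_ge0.
apply/nsq_eq0/eqP; by rewrite eq_le nsq_ge0 andbT (le_geometric0 norm_quarter H).
Qed.

End partial_sums.

(** * Hardy space, Toeplitz and Hankel operators, and the kernel of the self-commutator *)

Section hardy.
Context {R : realType}.
Implicit Types (f g h u v b : R -> R[i]) (c : R[i]).
Local Notation mu := (circle_prob R).
Local Notation L2 := (Lp 2%:E).
Local Notation Linf := (Lp +oo%E).
Local Notation coef := fourier_coef.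

(** The orthogonal complement of H^2 in L^2, described by coefficients; [dot_H2perp] and [H2perpP]
    translate it into inner products. *)
Definition H2perp f := L2 f /\ forall n : int, 0 <= n -> coef f n = 0.

Lemma H2_L2 f : H2 f -> L2 f. Proof. by case. Qed.

Lemma Hinf_H2 f : Hinf f -> H2 f.
Proof. by move=> [fi f0]; split => //; exact: Linf_L2. Qed.

Lemma H2_ae f g : H2 f -> L2 g -> aeq f g -> H2 g.
Proof. by move=> [fi f0] gi fg; split => // n /f0 <-; apply/esym/fcoef_ae. Qed.

Lemma H2perp_ae f g : H2perp f -> L2 g -> aeq f g -> H2perp g.
Proof. by move=> [fi f0] gi fg; split => // n /f0 <-; apply/esym/fcoef_ae. Qed.

Lemma H2D f g : H2 f -> H2 g -> H2 (fun t => f t + g t).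
Proof.
by move=> [fi f0] [gi g0]; split=> [|n n0]; [exact: L2D|rewrite fcoefD // f0 // g0 // addr0].
Qed.

Lemma H2B f g : H2 f -> H2 g -> H2 (fun t => f t - g t).
Proof.
by move=> [fi f0] [gi g0]; split=> [|n n0]; [exact: L2B|rewrite fcoefB // f0 // g0 // subr0].
Qed.

Lemma H2Z c f : H2 f -> H2 (fun t => c * f t).
Proof.
by move=> [fi f0]; split=> [|n n0]; [exact: L2Z|rewrite fcoefZ // f0 // mulr0].
Qed.

Lemma H2perpD f g : H2perp f -> H2perp g -> H2perp (fun t => f t + g t).
Proof.
by move=> [fi f0] [gi g0]; split=> [|n n0]; [exact: L2D|rewrite fcoefD // f0 // g0 // addr0].
Qed.

Lemma H2perpB f g : H2perp f -> H2perp g -> H2perp (fun t => f t - g t).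
Proof.
by move=> [fi f0] [gi g0]; split=> [|n n0]; [exact: L2B|rewrite fcoefB // f0 // g0 // subr0].
Qed.

Lemma H2perpZ c f : H2perp f -> H2perp (fun t => c * f t).
Proof.
by move=> [fi f0]; split=> [|n n0]; [exact: L2Z|rewrite fcoefZ // f0 // mulr0].
Qed.

Lemma H2_cst c : H2 (fun=> c).
Proof.
split=> [|n n0]; first exact: L2_cst.
by rewrite fcoef_cst lt_eqF.
Qed.

Lemma Hinf_expz (k : nat) : Hinf (expz k : R -> R[i]).
Proof.
split=> [|n n0]; first exact: Linf_expz.
by rewrite fcoef_expz gt_eqF // (lt_le_trans n0).
Qed.

Lemma dot_H2perp v g : H2perp v -> H2 g -> dotL2 v g = 0.
Proof.
move=> [vi v0] [gi g0]; apply: dot_disjoint => // n.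
by have [/g0|/v0] := ltP n 0; [right|left].
Qed.

Lemma H2perpP v : L2 v -> (forall g, H2 g -> dotL2 v g = 0) -> H2perp v.
Proof.
move=> vi H; split => // n n0; have := H (expz n); apply.
by case: n n0 => // n _; exact/Hinf_H2/Hinf_expz.
Qed.

Lemma H2perp_eq0 f : H2 f -> H2perp f -> aeq f (fun=> 0).
Proof. by move=> f1 f2; apply: aeq_perp; [case: f1|exact: dot_H2perp]. Qed.

Lemma Hinf_mulH2 b f : Hinf b -> H2 f -> H2 (fun t => b t * f t).
Proof.
move=> [bi b0] [fi f0]; split=> [|n n0]; first exact: Linf_mulL2.
rewrite /fourier_coef dotMl; apply: dot_disjoint => //.
  exact/Linf_mulL2/L2_expz/LinfJ.
move=> k; have [k0|k0] := ltP k 0; [left; exact: f0|right].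
rewrite (_ : (fun t => _) = fun t => expz n t * conjc (b t)); last first.
  by apply/funext => t; rewrite mulrC.
rewrite fcoef_shift fcoefJ ?b0 ?conjc0 //; last exact: Linf_L2.
by rewrite opprB subr_lt0 (lt_le_trans n0).
Qed.

Lemma HinfM f g : Hinf f -> Hinf g -> Hinf (fun t => f t * g t).
Proof.
move=> fi gi; have [_ H] := Hinf_mulH2 fi (Hinf_H2 gi).
by split => //; apply: LinfM; [case: fi|case: gi].
Qed.

Lemma HinfJ_mulH2perp b v : Hinf b -> H2perp v ->
  H2perp (fun t => conjc (b t) * v t).
Proof.
move=> bi [vi v0]; have bl := bi.1.
apply: H2perpP; first exact/Linf_mulL2/vi/LinfJ.
move=> g gi; rewrite dotMl; under eq_fun do rewrite conjcK.
by apply: dot_H2perp => //; exact: Hinf_mulH2.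
Qed.

Lemma proj_exists f : L2 f -> exists h, H2 h /\ H2perp (fun t => f t - h t).
Proof.
move=> fi; have [h [hi hc _]] := riesz_fischer (fun n : int => 0 <= n) fi.
exists h; split; first by split => // n n0; rewrite hc leNgt n0.
by split=> [|n n0]; [exact: L2B|rewrite fcoefB // hc n0 subrr].
Qed.

Lemma projH2P f : L2 f -> H2 (projH2 f) /\ H2perp (fun t => f t - projH2 f t).
Proof.
move=> fi; have [h [h2 hp]] := proj_exists fi.
have [P1 P2] : [set h | H2 h /\ forall g, H2 g ->
    dotL2 (fun t => f t - h t) g = 0] (projH2 f).
  by apply: xgetPex; exists h; split => // g; exact: dot_H2perp.
by split => //; apply: H2perpP => //; apply: L2B => //; exact: H2_L2.
Qed.

Lemma proj_unique f h k : H2 h -> H2perp (fun t => f t - h t) ->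
  H2 k -> H2perp (fun t => f t - k t) -> aeq h k.
Proof.
move=> h2 hp k2 kp; have H : H2perp (fun t => h t - k t).
  have := H2perpB kp hp; congr H2perp; apply/funext => t; ring.
by apply: (aeS (H2perp_eq0 (H2B h2 k2) H)) => t /eqP; rewrite subr_eq0 => /eqP.
Qed.

Lemma toeplitzP (phi g : R -> R[i]) : Linf phi -> L2 g ->
  H2 (toeplitz phi g) /\ H2perp (fun t => phi t * g t - toeplitz phi g t).
Proof. by move=> pi gi; apply: projH2P; exact: Linf_mulL2. Qed.

Lemma dot_toeplitz (phi f g : R -> R[i]) : Linf phi -> L2 f -> H2 g ->
  dotL2 (toeplitz phi f) g = dotL2 (fun t => phi t * f t) g.
Proof.
move=> pi fi g2; have [T1 T2] := toeplitzP pi fi.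
have := dot_H2perp T2 g2; rewrite dotBl; [|exact: Linf_mulL2|exact: H2_L2..].
by move/eqP; rewrite subr_eq0 => /eqP.
Qed.

Lemma adj_toeplitz (phi g : R -> R[i]) : Linf phi -> H2 g ->
  H2 (adjH2 (toeplitz phi) g) /\
  aeq (adjH2 (toeplitz phi) g) (toeplitz (fun t => conjc (phi t)) g).
Proof.
move=> pi g2; have gi := H2_L2 g2; have pJ := LinfJ pi.
have [T1 T2] := toeplitzP pJ gi.
have H f : H2 f -> dotL2 (toeplitz phi f) g =
    dotL2 f (toeplitz (fun t => conjc (phi t)) g).
  move=> f2; have fi := H2_L2 f2; rewrite dot_toeplitz // dotMl.
  rewrite (dotC (H2_L2 T1) fi) dot_toeplitz // -dotC //.
  exact: Linf_mulL2.
have [A1 A2] : [set h | H2 h /\ forall f, H2 f -> dotL2 (toeplitz phi f) g = dotL2 f h]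
    (adjH2 (toeplitz phi) g).
  by apply: xgetPex; exists (toeplitz (fun t => conjc (phi t)) g).
split => //; set h := adjH2 _ _ in A1 A2 *; set k := toeplitz _ _ in T1 T2 H *.
have hk := H2B A1 T1.
have /aeq_perp H0 : L2 (fun t => h t - k t) by exact: H2_L2.
have E : dotL2 (fun t => h t - k t) (fun t => h t - k t) = 0.
  rewrite dotBr; [|exact: H2_L2..].
  by rewrite -A2 // -H // subrr.
by apply: (aeS (H0 E)) => t /eqP; rewrite subr_eq0 => /eqP.
Qed.

(** Applied to conj(phi) and to phi, this gives the functions u and v of the overview. *)
Definition hankel (phi f : R -> R[i]) : R -> R[i] :=
  fun t => phi t * f t - toeplitz phi f t.

Lemma hankelP (phi f : R -> R[i]) : Linf phi -> L2 f -> H2perp (hankel phi f).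
Proof. by move=> pi fi; have [] := toeplitzP pi fi. Qed.

Lemma hankel_unique (phi f g : R -> R[i]) : Linf phi -> L2 f -> H2 g ->
  H2perp (fun t => phi t * f t - g t) ->
  aeq (toeplitz phi f) g /\ aeq (hankel phi f) (fun t => phi t * f t - g t).
Proof.
move=> pi fi g2 gp; have [T1 T2] := toeplitzP pi fi.
have H := proj_unique T1 T2 g2 gp; split => //.
by apply: (aeS H) => t; rewrite /hankel => ->.
Qed.

Let selfcomm_ring (p q x y z w w' : R[i]) :
  (q * z - w) - (p * y - w') = p * (q * x - y) - q * (p * x - z) - (w - w').
Proof. ring. Qed.

(** The self-commutator is f -> P(phi u - conj(phi) v): the two terms |phi|^2 f cancel, leaving
    conj(phi) T f - phi T* f up to null sets. *)
Lemma selfcommP (phi f : R -> R[i]) : Linf phi -> H2 f ->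
  H2 (selfcomm (toeplitz phi) f) /\
  H2perp (fun t => phi t * hankel (fun s => conjc (phi s)) f t -
    conjc (phi t) * hankel phi f t - selfcomm (toeplitz phi) f t).
Proof.
move=> pi f2; have fi := H2_L2 f2; have pJ := LinfJ pi.
have [T1 T2] := toeplitzP pi fi; have [S1 S2] := toeplitzP pJ fi.
have [A1 A2] := adj_toeplitz pi f2; have [B1 B2] := adj_toeplitz pi T1.
have [C1 C2] := toeplitzP pi (H2_L2 A1); have [D1 D2] := toeplitzP pJ (H2_L2 T1).
split; first exact: H2B.
have Sc : H2 (selfcomm (toeplitz phi) f) by exact: H2B.
apply: (H2perp_ae (H2perpB D2 C2)).
  apply: L2B; last exact: H2_L2.
  have [u1 _] := hankelP pJ fi; have [u2 _] := hankelP pi fi.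
  by apply: L2B; exact: Linf_mulL2.
apply: (aeS2 A2 B2) => t a b; rewrite /selfcomm /hankel b a.
exact: selfcomm_ring.
Qed.

Lemma nrm_ge_eq0 u v : L2 u -> L2 v ->
  (\forall t \ae mu, nsq (v t) <= nsq (u t)) -> nrm u <= nrm v ->
  \forall t \ae mu, nsq (v t) = nsq (u t).
Proof.
move=> ui vi vu uv; have [[mu1 u1] [mv1 v1]] := ((L2P u).1 ui, (L2P v).1 vi).
have E : nrm u = nrm v by apply/eqP; rewrite eq_le uv le_nrm.
pose F (t : R) := nsq (u t) - nsq (v t).
have mF : measurable_fun setT (F : measurableTypeR R -> R).
  by apply: measurable_funB; [have := cmeas_nsq mu1|have := cmeas_nsq mv1]; exact.
have mFe : measurable_fun setT (fun t : measurableTypeR R => (F t)%:E).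
  exact/measurable_EFinP.
have F0 : (\int[mu]_t `|(F t)%:E| = 0)%E.
  transitivity (\int[mu]_t (F t)%:E)%E.
    apply: ae_eq_integral => //; first exact: measurableT_comp.
    by apply: (aeS vu) => t vut _ /=; rewrite ger0_norm // subr_ge0.
  have iF := integrableB measurableT u1 v1.
  have := RintegralB measurableT u1 v1.
  rewrite -/(nrm u) -/(nrm v) E subrr /Rintegral => H.
  by rewrite -[LHS](fineK (integrable_fin_num measurableT iF)) H.
have /(ae_eq_integral_abs mu measurableT mFe) H := F0.
by apply: (aeS H) => t /(_ I) [] /eqP; rewrite subr_eq0 => /eqP ->.
Qed.

(** Here x, y, z, w stand for the squared norms of b u, v, b u - v and u. *)
Let balance (x y z w : R) : x = y + z -> w = y -> x <= w -> 0 <= z ->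
  z = 0 /\ w <= x.
Proof. by move=> -> -> xw z0; split; lra. Qed.

Section symbol.
Variables (phi b : R -> R[i]).
Hypotheses (phi_Linf : Linf phi) (phi_b : calE phi b).
Let phiJ t := conjc (phi t).
Let T := toeplitz phi.
Let u f := hankel phiJ f.
Let v f := hankel phi f.
Let h t := phi t - b t * phiJ t.
Let K := kerH2 (selfcomm T).

Lemma calE_Hinf : Hinf b. Proof. by case: phi_b. Qed.

Lemma calE_nsq_le1 : \forall t \ae mu, nsq (b t) <= 1.
Proof.
case: phi_b => _ /(normLpyP _ ler01) H _; apply: (aeS H) => t bt.
by rewrite -normc_sqr expr_le1 // normc_nsq sqrtr_ge0.
Qed.

Let h_Hinf : Hinf h. Proof. by case: phi_b. Qed.
Let phiJ_Linf : Linf phiJ. Proof. exact: LinfJ. Qed.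
Let b_Linf : Linf b. Proof. exact: calE_Hinf.1. Qed.

(** This is b u - v, by [defectE], written so that membership in H^2 is visible from its terms. *)
Definition defect f t := toeplitz phi f t - h t * f t - b t * toeplitz phiJ f t.

Lemma defectE f t : b t * u f t = v f t + defect f t.
Proof. by rewrite /u /v /hankel /defect /h; ring. Qed.

Lemma defect_H2 f : H2 f -> H2 (defect f).
Proof.
move=> f2; have fi := H2_L2 f2; apply: H2B.
  by apply: H2B; [have [] := toeplitzP phi_Linf fi|exact: Hinf_mulH2].
by apply: Hinf_mulH2; [exact: calE_Hinf|have [] := toeplitzP phiJ_Linf fi].
Qed.

Lemma hankel_L2 (psi f : R -> R[i]) : Linf psi -> L2 f -> L2 (hankel psi f).
Proof. by move=> pi fi; have [] := hankelP pi fi. Qed.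

Lemma dot_hankel (psi f : R -> R[i]) : Linf psi -> H2 f ->
  dotL2 (hankel psi f) (fun t => psi t * f t) = (nrm (hankel psi f))%:C.
Proof.
move=> pi f2; have fi := H2_L2 f2; rewrite -dotff.
have [T1 _] := toeplitzP pi fi; have hp := hankelP pi fi.
have -> : (fun t => psi t * f t) = fun t => hankel psi f t + toeplitz psi f t.
  by apply/funext => t; rewrite /hankel subrK.
rewrite dotDr; [|exact: hankel_L2|exact: H2_L2|exact: hankel_L2].
by rewrite (dot_H2perp hp T1) addr0.
Qed.

Lemma ker_defect f : K f -> aeq (defect f) (fun=> 0) /\
  \forall t \ae mu, nsq (b t) * nsq (u f t) = nsq (u f t).
Proof.
move=> [f2 /aeqE Af]; have fi := H2_L2 f2.
have [_ Ap] := selfcommP phi_Linf f2.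
have uL : L2 (u f) by exact: hankel_L2.
have vL : L2 (v f) by exact: hankel_L2.
have wH := defect_H2 f2; have wL := H2_L2 wH.
have p1 : L2 (fun t => phi t * u f t) by exact: Linf_mulL2.
have p2 : L2 (fun t => phiJ t * v f t) by exact: Linf_mulL2.
(* Since the self-commutator kills f, its preimage under P is orthogonal to H^2. Pairing with f
   itself gives equal norms for u and v. *)
have : dotL2 (fun t => phi t * u f t - phiJ t * v f t) f = 0.
  apply: dot_H2perp => //; apply: (H2perp_ae Ap); first exact: L2B.
  by apply: (aeS Af) => t ->; rewrite subr0.
rewrite dotBl // !dotMl.
have -> : (fun t => conjc (phiJ t) * f t) = fun t => phi t * f t.
  by apply/funext => t; rewrite /phiJ conjcK.
rewrite -[fun t => conjc (phi t) * f t]/(fun t => phiJ t * f t) !dot_hankel //.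
rewrite -rmorphB => /complexI/eqP; rewrite subr_eq0 => /eqP uv.
have bu : nrm (fun t => b t * u f t) = nrm (v f) + nrm (defect f).
  rewrite -(pythagoras vL wL (dot_H2perp (hankelP phi_Linf fi) wH)).
  by rewrite /nrm; apply: eq_Rintegral => t _; congr nsq; exact: defectE.
have bL : L2 (fun t => b t * u f t) by exact: (Linf_mulL2 b_Linf uL).
have le1 : \forall t \ae mu, nsq (b t * u f t) <= nsq (u f t).
  by apply: (aeS calE_nsq_le1) => t bt; rewrite nsqM ler_piMl ?nsq_ge0.
have le2 := le_nrm bL uL le1; have w0 := nrm_ge0 (defect f).
have [d0 le3] := balance bu uv le2 w0.
split; first exact: nrm_eq0.
by apply: (aeS (nrm_ge_eq0 uL bL le1 le3)) => t; rewrite nsqM.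
Qed.

(** The hypotheses give v = b u and u = conj(b) v, so phi u - conj(phi) v = -conj(h) v, which is
    orthogonal to H^2 because h is in H^infinity. The self-commutator at f is thus both in H^2 and
    orthogonal to it. *)
Lemma defect_ker f : H2 f -> aeq (defect f) (fun=> 0) ->
  (\forall t \ae mu, nsq (b t) * nsq (u f t) = nsq (u f t)) -> K f.
Proof.
move=> f2 w0 bu; have fi := H2_L2 f2.
have [A2 Ap] := selfcommP phi_Linf f2.
have vp : H2perp (v f) by exact: hankelP.
split; first exact: f2.
apply/aeqE; apply: (H2perp_eq0 A2).
have hp := H2perpZ (-1) (HinfJ_mulH2perp h_Hinf vp).
apply: (H2perp_ae (H2perpB hp Ap)); first exact: H2_L2.
apply: (aeS2 w0 bu) => t wt but.
have vE : v f t = b t * u f t by rewrite defectE wt addr0.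
have uE : u f t = conjc (b t) * v f t.
  rewrite vE mulrA (mulrC _ (b t)) mulcJE.
  apply/eqP; rewrite -subr_eq0 -{1}[u f t]mul1r -mulrBl mulf_eq0; apply/orP.
  have : (1 - nsq (b t)) * nsq (u f t) = 0 by rewrite mulrBl mul1r but subrr.
  move/eqP; rewrite mulf_eq0 => /orP[/eqP H|/eqP/nsq_eq0 ->]; last by right.
  by left; rewrite -[1]/(1%:C) -rmorphB H.
have E : phi t * u f t = phi t * (conjc (b t) * v f t) by rewrite -uE.
rewrite -/(v f t) -/(u f t) E /h /phiJ rmorphB rmorphM /= conjcK.
move: (selfcomm _ f t) (v f t) (phi t) (conjc (phi t)) (conjc (b t)) => A V p q r.
ring.
Qed.

End symbol.
End hardy.

(** * Polynomials on the circle and division by their roots *)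

Section circle_polynomials.
Context {R : realType}.
Implicit Types (f g u : R -> R[i]) (p q : {poly R[i]}).
Local Notation mu := (circle_prob R).
Local Notation L2 := (Lp 2%:E).
Local Notation Linf := (Lp +oo%E).
Local Notation coef := fourier_coef.

Definition circle_poly q : R -> R[i] := fun t => q.[circle_var t].

Lemma fcoef_sum (F : nat -> R -> R[i]) N n : (forall i, L2 (F i)) ->
  L2 (fun t => \sum_(i < N) F i t) /\
  coef (fun t => \sum_(i < N) F i t) n = \sum_(i < N) coef (F i) n.
Proof.
move=> Fi; elim: N => [|N [IH1 IH2]].
  under eq_fun do rewrite big_ord0.
  by split; [exact: L2_cst|rewrite big_ord0 [LHS]dot0l].
under eq_fun do rewrite big_ord_recr.
by split; [exact: L2D|rewrite fcoefD // IH2 big_ord_recr].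
Qed.

Lemma fcoef_circle_poly q u n : L2 u ->
  coef (fun t => circle_poly q t * u t) n =
  \sum_(j < size q) q`_j * coef u (n - j%:Z).
Proof.
move=> ui; have Fi (j : nat) : L2 (fun t => q`_j * (expz j t * u t)).
  by apply/L2Z/Linf_mulL2 => //; exact: Linf_expz.
rewrite (_ : (fun t => _) = fun t => \sum_(j < size q) q`_j * (expz j t * u t)).
  rewrite (fcoef_sum _ _ Fi).2; apply: eq_bigr => j _.
  by rewrite fcoefZ ?fcoef_shift //; apply: Linf_mulL2 => //; exact: Linf_expz.
apply/funext => t; rewrite /circle_poly horner_coef mulr_suml.
by apply: eq_bigr => j _; rewrite mulrA.
Qed.

Lemma Hinf_circle_poly q : Hinf (circle_poly q).
Proof.
elim/poly_ind: q => [|q c IH].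
  rewrite (_ : circle_poly 0 = fun=> 0); last by apply/funext => t; rewrite /circle_poly horner0.
  by have [_ H] := H2_cst (0 : R[i]); split => //; exact: Linf_cst.
rewrite (_ : circle_poly _ = fun t => circle_poly q t * expz 1 t + c); last first.
  by apply/funext => t; rewrite /circle_poly !hornerE.
have [Ml Mc] := HinfM IH (Hinf_expz 1).
split; first by apply: LinfD => //; exact: Linf_cst.
by have [] := H2D (conj (Linf_L2 Ml) Mc) (H2_cst c).
Qed.

(** Equal values give cos(s - t) = 1, hence sin((s - t)/2) = 0, while |s - t|/2 is less than pi. *)
Lemma circle_var_inj (s t : R) : 0 < s < pi *+ 2 -> 0 < t < pi *+ 2 ->
  circle_var s = circle_var t -> s = t.
Proof.
move=> /andP[s0 s1] /andP[t0 t1] [cst sst].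
have pi2 : pi *+ 2 = 2 * pi :> R by rewrite mulr_natl.
have : cos ((s - t) / 2 *+ 2) = 1.
  rewrite -mulr_natr divfK // cosB cst sst -!expr2; exact: cos2Dsin2.
rewrite cos_mulr2n cos2sin2 => E.
have {}E : sin ((s - t) / 2) = 0.
  apply/eqP; rewrite -sqrf_eq0; apply/eqP.
  by move: (sin _ ^+ 2) E => x; rewrite mulrnBl -mulr_natr; lra.
case: (ltrgtP s t) => // st.
  have : 0 < sin ((t - s) / 2) by apply: sin_gt0_pi; apply/andP; split; lra.
  by rewrite -opprB mulNr sinN E oppr0 ltxx.
have : 0 < sin ((s - t) / 2) by apply: sin_gt0_pi; apply/andP; split; lra.
by rewrite E ltxx.
Qed.

Lemma circle_var_neq_ae (a : R[i]) : \forall t \ae mu, circle_var t != a.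
Proof.
have [[s [s0 <-]]|nex] := pselect (exists s : R, 0 < s < pi *+ 2 /\ circle_var s = a).
  apply: (circle_aeW (x := s)) => t t0 ts; apply: contra ts => /eqP/circle_var_inj.
  by move=> /(_ t0 s0) ->.
apply: (circle_aeW (x := 0)) => t t0 _; apply/eqP => ta.
by apply: nex; exists t.
Qed.

Lemma circle_poly_neq0_ae q : q != 0 -> \forall t \ae mu, circle_poly q t != 0.
Proof.
have [n] := ubnP (size q); elim: n q => // n IH q; rewrite ltnS => qn q0.
have [/size_poly1P[c c0 ->]|] := boolP (size q == 1%N).
  by apply: aeW => t; rewrite /circle_poly hornerC.
move=> /closed_rootP[a /factor_theorem[q1 E]].
have q10 : q1 != 0 by apply: contra q0 => /eqP H; rewrite E H mul0r.
have sq : (size q1 < n)%N.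
  by rewrite (leq_trans _ qn) // E size_Mmonic ?monicXsubC // size_XsubC addn2.
apply: (aeS2 (IH _ sq q10) (circle_var_neq_ae a)) => t H1 H2.
by rewrite /circle_poly E hornerM mulf_neq0 // hornerXsubC subr_eq0.
Qed.

Lemma Linf_circle_poly q : Linf (circle_poly q).
Proof. by have [] := Hinf_circle_poly q. Qed.

(* Write g = phi^n q1. With g = g+ + G its decomposition along H^2, (z - a) G is a constant c, and
   F^2 = (z - a) q1 (phi^(2n) q) for F = (z - a) g gives c^2 = (z - a) X with X in H^2, so that
   c G = X and hence c = 0. *)
Lemma divide_root (phi : R -> R[i]) q a : Linf phi ->
  (forall n, H2 (fun t => phi t ^+ n * circle_poly (q * ('X - a%:P)) t)) ->
  forall n, H2 (fun t => phi t ^+ n * circle_poly q t).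
Proof.
move=> pi HF n; set g := fun t => _.
have gl : Linf g by apply: LinfM; [exact: LinfX|exact: Linf_circle_poly].
have gi := Linf_L2 gl.
pose F k t := phi t ^+ k * circle_poly (q * ('X - a%:P)) t.
have FE t : F n t = circle_var t * g t - a * g t.
  by rewrite /F /g /circle_poly hornerM hornerXsubC; ring.
have Fl : Linf (F n) by apply: LinfM; [exact: LinfX|exact: Linf_circle_poly].
have [[g1i g1c] Gp] := projH2P gi.
set g1 := projH2 g in g1i g1c Gp; pose G t := g t - g1 t.
have Gi : L2 G by case: Gp.
have zi f : L2 f -> L2 (fun t => expz 1 t * f t) by apply: Linf_mulL2; exact: Linf_expz.
have zc f m : L2 f -> coef (fun t => expz 1 t * f t - a * f t) m = coef f (m - 1) - a * coef f m.
  by move=> fi; rewrite fcoefB ?fcoef_shift ?fcoefZ //; [exact: zi|exact: L2Z].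
(* (z - a) g is in H^2, so its negative coefficients vanish. By this recurrence all negative
   coefficients of g vanish once the one at -1 does. *)
have rec m : m < 0 -> coef g (m - 1) = a * coef g m.
  move=> m0; apply/eqP; rewrite -subr_eq0 -zc //; apply/eqP.
  have [_ /(_ m m0) <-] := HF n; congr (coef _ m); apply/funext => t.
  by rewrite -[RHS]/(F n t) FE.
have Gc m : m < 0 -> coef G m = coef g m.
  by move=> m0; rewrite fcoefB // g1c // subr0.
pose c := coef g (-1).
(* The coefficient of (z - a) G vanishes at m < 0 by the recurrence and at m > 0 because G has only
   negative frequencies; at m = 0 only that of G at -1 remains. *)
have Gcst : aeq (fun t => expz 1 t * G t - a * G t) (fun=> c).
  apply: fcoef_inj; [by apply: L2B; [exact: zi|exact: L2Z]|exact: L2_cst|].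
  move=> m; rewrite zc // fcoef_cst; case: eqP => [->|/eqP m0].
    by rewrite sub0r Gc // Gp.2 // mulr0 subr0.
  have [m1|m1] := ltP m 0.
    by rewrite !Gc // ?rec ?subrr //; lia.
  by rewrite !Gp.2 ?mulr0 ?subrr //; lia.
have [c0|c0] := eqVneq c 0.
  have g0 (k : nat) : coef g (- (k.+1)%:Z) = 0.
    elim: k => [|k IH]; first exact: c0.
    rewrite (_ : - (k.+2)%:Z = - (k.+1)%:Z - 1); last by lia.
    by rewrite rec ?IH ?mulr0 //; lia.
  by split => // -[//|k _]; rewrite NegzE; exact: g0.
(* Obtained from c^2 = F^2 - (F + c)(F - c), where F^2 = (z - a) q F_(2n) and F - c = (z - a) g1
   each contain the factor z - a. *)
pose X t := circle_poly q t * F (2 * n)%N t - F n t * g1 t - c * g1 t.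
have X2 : H2 X.
  have g12 : H2 g1 by [].
  apply: H2B; last exact: H2Z.
  apply: H2B; first by apply: Hinf_mulH2; [exact: Hinf_circle_poly|exact: HF].
  by apply: Hinf_mulH2 => //; split => //; case: (HF n).
have XG : aeq (fun t => c^-1 * X t) G.
  apply: (aeS Gcst) => t E.
  have {}E : (circle_var t - a) * G t = c by rewrite mulrBl.
  have E2 : circle_poly q t * F (2 * n)%N t * (circle_var t - a) = F n t ^+ 2.
    rewrite /F /circle_poly hornerM hornerXsubC mulnC exprM; ring.
  have E3 : (circle_var t - a) * g1 t = F n t - c.
    by rewrite FE -E /G; ring.
  have E4 : (circle_var t - a) * X t = c ^+ 2.
    rewrite /X (_ : _ * _ = circle_poly q t * F (2 * n)%N t * (circle_var t - a)
      - (F n t + c) * ((circle_var t - a) * g1 t)); last by ring.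
    by rewrite E2 E3; ring.
  (* Replacing one factor c by (z - a) G compares X with c G without dividing by z - a. *)
  apply: (mulfI c0); rewrite mulrA divff // mul1r; apply: (mulfI c0).
  rewrite -{1}E mulrAC E4; ring.
have G2 : H2 G by apply: (H2_ae _ Gi XG); exact: H2Z.
have := H2perp_eq0 G2 Gp => G0.
case/eqP: c0; rewrite /c -Gc // (fcoef_ae _ Gi (L2_cst 0) G0).
by rewrite [LHS]dot0l.
Qed.

Lemma H2_of_poly_multiple (phi : R -> R[i]) q : Linf phi -> q != 0 ->
  (forall n, H2 (fun t => phi t ^+ n * circle_poly q t)) -> H2 phi.
Proof.
move=> pi; have [n] := ubnP (size q); elim: n q => // n IH q; rewrite ltnS => qn q0 H.
have [/size_poly1P[c c0 E]|] := boolP (size q == 1%N).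
  have := H2Z c^-1 (H 1%N); congr H2; apply/funext => t.
  by rewrite /circle_poly E hornerC expr1 mulrC mulfK.
move=> /closed_rootP[a /factor_theorem[q1 E]].
have q10 : q1 != 0 by apply: contra q0 => /eqP Hq; rewrite E Hq mul0r.
apply: (IH q1) => //.
  by rewrite (leq_trans _ qn) // E size_Mmonic ?monicXsubC // size_XsubC addn2.
by apply: (divide_root (a := a)) => //; rewrite -E.
Qed.

End circle_polynomials.

(** * Invariance of the kernel and vanishing of its Hankel images *)

Section kernel.
Context {R : realType}.
Implicit Types (f g k u b : R -> R[i]) (c : R[i]) (q : {poly R[i]}).
Local Notation mu := (circle_prob R).
Local Notation L2 := (Lp 2%:E).
Local Notation Linf := (Lp +oo%E).
Local Notation coef := fourier_coef.

(** Taking [k] only almost everywhere equal to the combination covers linearity and, with c = 0,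
    independence of the representative. *)
Lemma toeplitz_lin (phi f g k : R -> R[i]) c : Linf phi -> L2 f -> L2 g -> L2 k ->
  aeq k (fun t => f t + c * g t) ->
  aeq (toeplitz phi k) (fun t => toeplitz phi f t + c * toeplitz phi g t).
Proof.
move=> pi fi gi ki E; have [Tk1 Tk2] := toeplitzP pi ki.
have [Tf1 Tf2] := toeplitzP pi fi; have [Tg1 Tg2] := toeplitzP pi gi.
have S2 := H2D Tf1 (H2Z c Tg1).
apply: (proj_unique Tk1 Tk2 S2); apply: (H2perp_ae (H2perpD Tf2 (H2perpZ c Tg2))).
  by apply: L2B; [exact: Linf_mulL2|exact: H2_L2].
by apply: (aeS E) => t ->; ring.
Qed.

Lemma selfcomm_lin (phi f g k : R -> R[i]) c : Linf phi -> H2 f -> H2 g -> H2 k ->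
  aeq k (fun t => f t + c * g t) ->
  aeq (selfcomm (toeplitz phi) k)
    (fun t => selfcomm (toeplitz phi) f t + c * selfcomm (toeplitz phi) g t).
Proof.
move=> pi f2 g2 k2 E; have pJ := LinfJ pi.
have [Ak1 Ak2] := selfcommP pi k2.
have [Af1 Af2] := selfcommP pi f2; have [Ag1 Ag2] := selfcommP pi g2.
have fi := H2_L2 f2; have gi := H2_L2 g2; have ki := H2_L2 k2.
apply: (proj_unique Ak1 Ak2 (H2D Af1 (H2Z c Ag1))).
apply: (H2perp_ae (H2perpD Af2 (H2perpZ c Ag2))).
  apply: L2B; last exact/H2_L2/(H2D Af1 (H2Z c Ag1)).
  by apply: L2B; apply: Linf_mulL2 => //; exact: hankel_L2.
have E1 := toeplitz_lin pi fi gi ki E; have E2 := toeplitz_lin pJ fi gi ki E.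
apply: (aeS2 E (aeI E1 E2)) => t kt [e1 e2].
rewrite /hankel e1 e2 kt.
move: (toeplitz _ f t) (toeplitz phi g t) (toeplitz _ f t) (toeplitz _ g t).
move: (selfcomm _ f t) (selfcomm _ g t) (f t) (g t) (phi t) (conjc (phi t)).
by move=> *; ring.
Qed.

Lemma selfcomm_sum (phi : R -> R[i]) (l : nat -> R[i]) (F : nat -> R -> R[i]) N :
  Linf phi -> (forall i, H2 (F i)) ->
  H2 (fun t => \sum_(i < N) l i * F i t) /\
  aeq (selfcomm (toeplitz phi) (fun t => \sum_(i < N) l i * F i t))
    (fun t => \sum_(i < N) l i * selfcomm (toeplitz phi) (F i) t).
Proof.
move=> pi F2; elim: N => [|N [IH1 IH2]].
  under eq_fun do rewrite big_ord0.
  have z2 := H2_cst (0 : R[i]); split => //.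
  have E : aeq (fun=> 0 : R[i]) (fun t => 0 + -1 * 0).
    by apply: aeW => t; rewrite mulr0 addr0.
  apply: (aeS (selfcomm_lin pi z2 z2 z2 E)) => t ->.
  by rewrite big_ord0 mulN1r subrr.
have S2 := H2D IH1 (H2Z (l N) (F2 N)).
have E : (fun t => \sum_(i < N.+1) l i * F i t) =
    fun t => \sum_(i < N) l i * F i t + l N * F N t.
  by apply/funext => t; rewrite big_ord_recr.
rewrite E; split => //.
have H := selfcomm_lin pi IH1 (F2 N) S2 (aeq_refl _).
by apply: (aeS2 H IH2) => t -> ->; rewrite big_ord_recr.
Qed.

Section symbol.
Variable phi : R -> R[i].
Hypothesis phi_Linf : Linf phi.
Let phiJ t := conjc (phi t).
Let phiJ_Linf : Linf phiJ. Proof. exact: LinfJ. Qed.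
Let K := kerH2 (selfcomm (toeplitz phi)).
Let T := toeplitz phi.

Lemma ker_ae f g : K f -> H2 g -> aeq f g -> K g.
Proof.
move=> [f2 /aeqE Af] g2 fg; split => //; apply/aeqE.
have E : aeq g (fun t => f t + 0 * f t) by apply: (aeS fg) => t ->; rewrite mul0r addr0.
by apply: (aeS2 Af (selfcomm_lin phi_Linf f2 f2 g2 E)) => t -> ->; rewrite mul0r addr0.
Qed.

(** The n + 1 functions z^(d+j) f have images in a span of n functions, so a nontrivial combination
    of them lies in the kernel. Starting at z^d forces the size above d. *)
Lemma ker_poly f d : finite_rank (selfcomm (toeplitz phi)) -> H2 f ->
  exists q, (d < size q)%N /\ K (fun t => circle_poly q t * f t).
Proof.
move=> [n [e [e2 He]]] f2.
pose F (j : nat) t := expz (d + j)%N t * f t.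
have F2 j : H2 (F j) by apply: Hinf_mulH2 => //; exact: Hinf_expz.
have /choice[c Hc] j : exists cj : 'I_n -> R[i],
    aeq (selfcomm T (F j)) (fun t => \sum_(i < n) cj i * e i t).
  by have [cj /aeqE] := He _ (F2 j); exists cj.
pose C := \matrix_(j < n.+1, i < n) c j i.
have : kermx C != 0.
  rewrite kermx_eq0 /row_free; apply/eqP => rC.
  by have := rank_leq_col C; rewrite rC ltnn.
move=> /rowV0Pn[w /sub_kermxP wC w0].
pose l (j : nat) := w 0 (inord j : 'I_n.+1).
have p0 : rVpoly w != 0.
  by apply: contra w0 => /eqP H; rewrite -(rVpolyK w) H linear0.
have [S2 S] := selfcomm_sum l n.+1 phi_Linf F2.
have E : (fun t => \sum_(i < n.+1) l i * F i t) =
    (fun t => circle_poly (rVpoly w * 'X^d) t * f t).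
  apply/funext => t; rewrite /circle_poly hornerM hornerXn /rVpoly horner_poly.
  rewrite !mulr_suml; apply: eq_bigr => i _.
  rewrite valK /l inord_val /F /expz -exprnP exprD; ring.
exists (rVpoly w * 'X^d); split.
  by rewrite size_mulXn // -[X in (X < _)%N]addn0 ltn_add2l lt0n size_poly_eq0.
rewrite -E; split; first exact: S2.
apply/aeqE.
(* Gathers finitely many almost everywhere identities into one exceptional null set. *)
have allc : forall N, \forall t \ae mu, forall j : nat, (j < N)%N ->
    selfcomm T (F j) t = \sum_(i < n) c j i * e i t.
  elim=> [|N IH]; first exact: aeW.
  apply: (aeS2 IH (Hc N)) => t H1 H2 j; rewrite ltnS leq_eqVlt => /orP[/eqP ->//|].
  exact: H1.
apply: (aeS2 S (allc n.+1)) => t -> Hj.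
transitivity (\sum_(i < n) (\sum_(j < n.+1) w 0 j * C j i) * e i t).
  under [RHS]eq_bigr do rewrite mulr_suml.
  rewrite exchange_big /=; apply: eq_bigr => j _.
  rewrite Hj // mulr_sumr; apply: eq_bigr => i _.
  by rewrite /l inord_val mxE mulrA.
rewrite big1 // => i _.
by have := congr1 (fun M : 'rV[R[i]]_n => M 0 i) wC; rewrite !mxE => ->; rewrite mul0r.
Qed.

Hypothesis ker_inv : invariant_under T K.

Lemma ker_toeplitz f : K f -> K (T f).
Proof.
move=> Kf; have [g Kg /aeqE Tg] := ker_inv Kf.
apply: (ker_ae Kg); last exact: aeq_sym.
by have [] := toeplitzP phi_Linf (H2_L2 Kf.1).
Qed.

Variable b : R -> R[i].
Hypothesis phi_b : calE phi b.
Let u f := hankel phiJ f.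
Let v f := hankel phi f.
Let b_Hinf : Hinf b := calE_Hinf phi_b.
Let h t := phi t - b t * phiJ t.
Let h_Hinf : Hinf h. Proof. by case: phi_b. Qed.

Lemma ker_hankelE f : K f -> aeq (v f) (fun t => b t * u f t).
Proof.
move=> Kf; have [w0 _] := ker_defect phi_Linf phi_b Kf.
by apply: (aeS w0) => t wt; rewrite defectE wt addr0.
Qed.

(* If every conj(phi) f with f in K is in H^2, so is every phi^n q for a polynomial q in K. *)
Lemma analytic_of_hankel0 : finite_rank (selfcomm T) ->
  (forall f, K f -> aeq (u f) (fun=> 0)) -> Hinf phi.
Proof.
(* Applied to f = 1, so that q itself is a nonzero polynomial in the kernel. *)
move=> fr u0; have [q [q0 Kq]] := ker_poly 0 fr (H2_cst 1).
have Kphi f : K f -> K (fun t => phi t * f t).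
  move=> Kf; have fi := H2_L2 Kf.1.
  have E : aeq (T f) (fun t => phi t * f t).
    apply: (aeS2 (ker_hankelE Kf) (u0 _ Kf)) => t vt ut.
    move/eqP: vt; rewrite ut mulr0 /v /hankel subr_eq0 => /eqP ->//.
  apply: (ker_ae (ker_toeplitz Kf)) => //.
  by apply: (H2_ae _ _ E); [have [] := toeplitzP phi_Linf fi|exact: Linf_mulL2].
have Kn n : K (fun t => phi t ^+ n * circle_poly q t).
  elim: n => [|n IH].
    by move: Kq; congr K; apply/funext => t; rewrite mulr1 mul1r.
  by under eq_fun do rewrite exprS -mulrA; exact: Kphi.
have [_ pc] : H2 phi.
  by apply: (@H2_of_poly_multiple _ phi q) => // [|n]; [rewrite -size_poly_gt0|case: (Kn n)].
by split.
Qed.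

(* The case |b| < 1 on a set of positive measure: u = u_f vanishes there. Multiply by a polynomial
   q of large degree with q f in K: then q u - u_{q f} is a polynomial vanishing there as well. *)
Lemma hankel0_of_nonunimodular f : finite_rank (selfcomm T) ->
  ~ (\forall t \ae mu, nsq (b t) = 1) -> K f -> aeq (u f) (fun=> 0).
Proof.
move=> fr nb Kf; have f2 := Kf.1; have fi := H2_L2 f2.
have [ui up] := hankelP phiJ_Linf fi; rewrite -/(u f) in ui up.
apply: fcoef_null_eq0; split => // n; have [n0|n0] := ltP n 0; last exact: up.
apply: contrapT => cn.
(* Assuming u is not 0, -d will be its highest frequency; it exists because u has only negative
   ones. *)
have ex : exists d : nat, coef (u f) (- d%:Z) != 0.
  by exists `|n|%N; rewrite ltz0_abs // opprK; apply/eqP.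
case: (ex_minnP ex) => d cd dmin.
have d0 : (0 < d)%N.
  by rewrite lt0n; apply: contra cd => /eqP ->; rewrite up.
have hi (m : int) : - d%:Z < m -> coef (u f) m = 0.
  have [m0 dm|m0 _] := ltP m 0; last exact: up.
  apply/eqP; apply: contraT => cm; have := dmin `|m|%N.
  by rewrite ltz0_abs // opprK cm => /(_ isT); lia.
have [q [qd Kq]] := ker_poly d fr f2.
set m := (size q).-1; have sq : size q = m.+1 by rewrite /m prednK //; lia.
(* The part of q u with nonnegative frequencies. The highest frequency of q u is at most m - d < m,
   so r is a polynomial, and u_{q f} = q u - r. *)
pose r := \poly_(k < m) coef (fun t => circle_poly q t * u f t) k%:Z.
have rsz : (size r <= m)%N by exact: size_poly.
have qu : L2 (fun t => circle_poly q t * u f t).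
  by apply: Linf_mulL2 => //; exact: Linf_circle_poly.
have rH := Hinf_H2 (Hinf_circle_poly r).
have rc (k : int) : 0 <= k -> coef (circle_poly r) k = coef (fun t => circle_poly q t * u f t) k.
  case: k => // k _.
  have := fcoef_circle_poly r k%:Z (L2_cst 1).
  rewrite (_ : (fun t => _) = circle_poly r); last by apply/funext => t; rewrite mulr1.
  move=> ->; under eq_bigr do rewrite fcoef_cst subr_eq0 eqz_nat.
  have -> : \sum_(i < size r) r`_i * (if k == i :> nat then 1 else 0) = r`_k.
    have [ks|ks] := ltnP k (size r).
      rewrite (bigD1 (Ordinal ks)) //= eqxx mulr1 big1 ?addr0 // => i.
      by rewrite -val_eqE /= eq_sym => /negbTE ->; rewrite mulr0.
    rewrite nth_default // big1 // => i _.
    by rewrite gtn_eqF ?mulr0 // (leq_trans (ltn_ord i)).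
  rewrite coef_poly; case: ltnP => // mk.
  rewrite fcoef_circle_poly // big1 // => j _.
  by rewrite hi ?mulr0 //; have := leq_trans (ltn_ord j) (eq_leq sq); lia.
have Hp : H2perp (fun t => circle_poly q t * u f t - circle_poly r t).
  split=> [|k k0]; first exact/L2B/H2_L2.
  by rewrite fcoefB ?rc ?subrr //; exact: H2_L2.
pose G t := circle_poly q t * toeplitz phiJ f t + circle_poly r t.
have G2 : H2 G.
  apply: H2D => //; apply: Hinf_mulH2; first exact: Hinf_circle_poly.
  by have [] := toeplitzP phiJ_Linf fi.
have qfi := H2_L2 Kq.1.
have [_ uq] : aeq (toeplitz phiJ (fun t => circle_poly q t * f t)) G /\
    aeq (u (fun t => circle_poly q t * f t))
      (fun t => phiJ t * (circle_poly q t * f t) - G t).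
  apply: hankel_unique => //.
  move: Hp; congr H2perp; apply/funext => t; rewrite /u /hankel /G; ring.
have r0 : r = 0.
  apply/eqP; apply: contraT => r0; exfalso; apply: nb.
  have [_ B1] := ker_defect phi_Linf phi_b Kf.
  have [_ B2] := ker_defect phi_Linf phi_b Kq.
  apply: (aeS2 (aeI B1 B2)
    (aeI uq (circle_poly_neq0_ae r0))).
  move=> t [b1 b2] [uqt rt]; apply: contrapT => bt.
  (* At a point where |b| is not 1 both u and u_{q f} vanish, hence so does r = q u - u_{q f}; off a
     null set a nonzero r has no zeros. *)
  have Z (x : R[i]) : nsq (b t) * nsq x = nsq x -> x = 0.
    move=> /eqP; rewrite -subr_eq0 -{2}[nsq x]mul1r -mulrBl mulf_eq0 subr_eq0.
    by move=> /orP[/eqP|/eqP/nsq_eq0].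
  have u1 := Z _ b1; have u2 := Z _ b2.
  case/eqP: rt; rewrite -[LHS]opprK -[RHS]oppr0; congr (- _).
  rewrite -u2 [RHS]uqt /G -[LHS]add0r -(mulr0 (circle_poly q t)) -{1}u1 /hankel; ring.
(* At frequency m - d, nonnegative since q has degree m >= d, only the leading coefficient of q
   meets the top coefficient of u; their product is not 0. *)
have kd : coef (fun t => circle_poly q t * u f t) (m - d)%N%:Z = 0.
  have := rc (m - d)%N%:Z isT; rewrite r0 => <-.
  rewrite (_ : circle_poly 0 = fun=> 0) ?[LHS]dot0l //.
  by apply/funext => t; rewrite /circle_poly horner0.
move/eqP: kd; rewrite fcoef_circle_poly // sq big_ord_recr /= big1 ?add0r; last first.
  by move=> j _; rewrite hi ?mulr0 //; have := ltn_ord j; lia.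
rewrite (_ : _ - m%:Z = - d%:Z); last by lia.
rewrite mulf_eq0 (negbTE cd) orbF -[m]/((size q).-1) -/(lead_coef q) lead_coef_eq0.
by rewrite -size_poly_eq0 sq.
Qed.

Hypothesis b_unimodular : \forall t \ae mu, nsq (b t) = 1.
Hypothesis mul_ker_inv : invariant_under T (mulspace b K).

(* T(b f) = b g forces phi f - g = conj(b) (phi b f - b g) to be orthogonal to H^2, so g = T f. *)
Lemma ker_mul f : K f ->
  K (fun t => b t * f t) /\ aeq (u (fun t => b t * f t)) (fun t => b t * u f t).
Proof.
move=> Kf; have f2 := Kf.1; have fi := H2_L2 f2.
have bl := b_Hinf.1.
have bf2 : H2 (fun t => b t * f t) by exact: Hinf_mulH2.
have bfi := H2_L2 bf2.
have bKf : mulspace b K (fun t => b t * f t) by exists f.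
have [_ [g Kg <-] /aeqE Tbf] := mul_ker_inv bKf.
have gi := H2_L2 Kg.1.
have pg : L2 (fun t => phi t * f t - g t) by apply: L2B => //; exact: Linf_mulL2.
have bp : H2perp (fun t => b t * (phi t * f t - g t)).
  have [_ P] := toeplitzP phi_Linf bfi; apply: (H2perp_ae P); first exact: Linf_mulL2.
  by apply: (aeS Tbf) => t; rewrite -/T => ->; ring.
have gp : H2perp (fun t => phi t * f t - g t).
  apply: (H2perp_ae (HinfJ_mulH2perp b_Hinf bp)) => //.
  apply: (aeS b_unimodular) => t bt.
  by rewrite mulrA (mulrC (conjc _)) mulcJE bt mul1r.
have [_ vE] := hankel_unique phi_Linf fi Kg.1 gp.
have vi : L2 (v f) by exact: hankel_L2.
have bv : H2perp (fun t => b t * v f t).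
  apply: (H2perp_ae bp); first exact: Linf_mulL2.
  by apply: (aeS vE) => t; rewrite -/(v f) => ->.
have [Tf2 vp] := toeplitzP phi_Linf fi.
(* Since h f = phi f - b conj(phi) f, the function conj(phi) b f - (T f - h f) is exactly v; hence
   u_{b f} = v. *)
have [_ uE] : aeq (toeplitz phiJ (fun t => b t * f t)) (fun t => T f t - h t * f t) /\
    aeq (u (fun t => b t * f t))
      (fun t => phiJ t * (b t * f t) - (T f t - h t * f t)).
  apply: hankel_unique => //; first by apply: H2B => //; exact: Hinf_mulH2.
  move: vp; congr H2perp; apply/funext => t; rewrite -/(T f t) /h; ring.
have {}uE : aeq (u (fun t => b t * f t)) (v f).
  by apply: (aeS uE) => t ->; rewrite /v /hankel -/(T f t) /h; ring.
split; last by apply: (aeS2 uE (ker_hankelE Kf)) => t ->.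
apply: (defect_ker phi_Linf phi_b bf2); last first.
  by apply: (aeS b_unimodular) => t ->; rewrite mul1r.
(* The defect of b f is b v - v_{b f}, a difference of two functions orthogonal to H^2, and it also
   lies in H^2. *)
apply: H2perp_eq0; first exact: (defect_H2 phi_Linf phi_b).
have vbf := hankelP phi_Linf bfi.
apply: (H2perp_ae (H2perpB bv vbf)); first exact/H2_L2/(defect_H2 phi_Linf phi_b).
apply: (aeS uE) => t ut; rewrite -ut.
by have := defectE phi b (fun t => b t * f t) t; rewrite -/phiJ -/(u _) => ->; rewrite addrC addKr.
Qed.

Lemma hankel_mul_perp f n : K f -> H2perp (fun t => b t ^+ n * u f t).
Proof.
move=> Kf; have fi := H2_L2 Kf.1; have bl := b_Hinf.1.
suff [Kn E] : K (fun t => b t ^+ n * f t) /\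
    aeq (u (fun t => b t ^+ n * f t)) (fun t => b t ^+ n * u f t).
  apply: (H2perp_ae (hankelP phiJ_Linf (H2_L2 Kn.1))) => //.
  by apply: Linf_mulL2; [exact: LinfX|exact: hankel_L2].
elim: n => [|n [IH1 IH2]].
  rewrite (_ : (fun t => _) = f); last by apply/funext => t; rewrite mul1r.
  by split => //; apply: aeW => t; rewrite mul1r.
have [K1 E1] := ker_mul IH1.
have E : (fun t => b t ^+ n.+1 * f t) = fun t => b t * (b t ^+ n * f t).
  by apply/funext => t; rewrite exprS mulrA.
rewrite E; split; first exact: K1.
by apply: (aeS2 E1 IH2) => t -> ->; rewrite exprS mulrA.
Qed.

Lemma fcoef0_b_le1 : nsq (coef b 0) <= 1.
Proof.
have bi := Linf_L2 b_Hinf.1.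
have <- : nrm b = 1; last exact: fcoef_le_nrm.
rewrite /nrm -[RHS]Rintegral_circle_cst; apply: Rintegral_ae => //.
by have := cmeas_nsq (L2_cmeas bi); exact.
Qed.

(* With w = b^n u and v = b w, only the constant term of b contributes to the first
   nonvanishing coefficient of w = conj(b) v. *)
Lemma hankel0_of_unimodular f : nsq (coef b 0) < 1 -> K f -> aeq (u f) (fun=> 0).
Proof.
move=> b1 Kf; have fi := H2_L2 Kf.1; have bl := b_Hinf.1.
have ui : L2 (u f) by exact: hankel_L2.
pose w n t := b t ^+ n * u f t.
have wp n : H2perp (w n) by exact: hankel_mul_perp.
have wi n : L2 (w n) by case: (wp n).
have wn n : nrm (w n) = nrm (u f).
  have [mw mu1] := (L2_cmeas (wi n), L2_cmeas ui).
  apply: Rintegral_ae; [by have := cmeas_nsq mw; exact|by have := cmeas_nsq mu1; exact|].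
  by apply: (aeS b_unimodular) => t bt; rewrite nsqM nsqX bt expr1n mul1r.
pose beta := coef b 0.
have b'i : L2 (fun t => b t - beta) by apply: L2B; [exact: Linf_L2|exact: L2_cst].
have step (k : nat) : (forall n (j : nat), (j <= k)%N -> coef (w n) (- j%:Z) = 0) ->
    forall n, coef (w n) (- k.+1%:Z) = conjc beta * coef (w n.+1) (- k.+1%:Z).
  move=> IH n; set e := - k.+1%:Z.
  have ei := L2_expz e : L2 (expz e : R -> R[i]).
  have e'i : L2 (fun t => expz e t * (b t - beta)) by apply: Linf_mulL2 => //; exact: Linf_expz.
  have -> : coef (w n) e = dotL2 (fun t => conjc (b t) * w n.+1 t) (expz e).
    apply: dot_ae => //; [by apply: Linf_mulL2 => //; exact: LinfJ| |exact: aeq_refl].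
    apply: (aeS b_unimodular) => t bt.
    by rewrite /w exprS -mulrA mulrA (mulrC (conjc _)) mulcJE bt mul1r.
  rewrite dotMl (_ : (fun t => _) = fun t => expz e t * (b t - beta) + beta * expz e t); last first.
    by apply/funext => t; rewrite conjcK; ring.
  rewrite dotDr ?dotZr //; [|exact: L2Z].
  (* b - beta has only positive frequencies, so z^e (b - beta) lives strictly above e, where the
     coefficients of w_(n+1) vanish by induction or by orthogonality to H^2. *)
  rewrite dot_disjoint ?add0r // => m.
  have [me|me] := leP m e; [right|left].
    rewrite fcoef_shift fcoefB; [|exact: Linf_L2|exact: L2_cst].
    rewrite fcoef_cst subr_eq0; case: eqP => [->|/eqP me'].
      by rewrite subrr subrr.
    by rewrite b_Hinf.2 ?subr0 //; rewrite subr_lt0 lt_neqAle me' me.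
  have [m0|m0] := ltP m 0; last exact: (wp _).2.
  have := IH n.+1 `|m|%N; rewrite ltz0_abs // opprK; apply.
  by move: me m0; rewrite /e; lia.
have key (k : nat) : forall n (j : nat), (j <= k)%N -> coef (w n) (- j%:Z) = 0.
  elim: k => [|k IH] n j; first by rewrite leqn0 => /eqP ->; rewrite (wp n).2.
  rewrite leq_eqVlt => /orP[/eqP ->|]; last exact: IH.
  (* After s iterations the factor is conj(beta)^s, while every w_(n+s) has the norm of u; letting s
     grow kills the coefficient. *)
  have it s : coef (w n) (- k.+1%:Z) =
      conjc beta ^+ s * coef (w (n + s)%N) (- k.+1%:Z).
    elim: s => [|s IHs]; first by rewrite mul1r addn0.
    by rewrite IHs (step k IH) mulrA -exprSr addnS.
  apply: nsq_eq0; apply/eqP; rewrite eq_le nsq_ge0 andbT.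
  apply: (@le_geometric0 R _ (nrm (u f)) (nsq beta)).
    by rewrite ger0_norm ?nsq_ge0.
  move=> s; rewrite (it s) nsqM nsqX nsqJ mulrC ler_wpM2r ?exprn_ge0 ?nsq_ge0 //.
  by rewrite -(wn (n + s)%N); exact: fcoef_le_nrm.
apply: fcoef_null_eq0; split => // n.
have [n0|n0] := ltP n 0; last by have [_ ->] := hankelP phiJ_Linf fi.
have := key `|n|%N 0%N `|n|%N (leqnn _); rewrite ltz0_abs // opprK => <-.
by congr (coef _ n); apply/funext => t; rewrite /w mul1r.
Qed.

(** The squared norm of b - b_0 is 1 - |b_0|^2 = 0, so b is the constant b_0. Then b u - v is
    orthogonal to H^2 as well as in it, for every f. *)
Lemma ker_full_of_constant f : nsq (coef b 0) = 1 -> H2 f -> K f.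
Proof.
move=> b1 f2; have fi := H2_L2 f2; have bl := b_Hinf.1; have bi := Linf_L2 bl.
have nb : nrm b = 1.
  rewrite /nrm -[RHS]Rintegral_circle_cst; apply: Rintegral_ae => //.
  by have := cmeas_nsq (L2_cmeas bi); exact.
have bc : aeq b (fun=> coef b 0).
  have : nrm (fun t => b t + - coef b 0 * expz 0 t) = 0.
    rewrite nrmDZ //; last exact: L2_expz.
    rewrite nb nsqN b1 nrm_expz mulr1 -[dotL2 b _]/(coef b 0).
    have E : conjc (coef b 0) * coef b 0 = 1%:C by rewrite mulrC mulcJE b1.
    by rewrite rmorphN mulNr E /=; lra.
  move=> /nrm_eq0 H; apply: (aeS (H _)) => [|t].
    by apply: L2D => //; exact/L2Z/L2_expz.
  by rewrite expz0 mulr1 => /eqP; rewrite subr_eq0 => /eqP.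
apply: (defect_ker phi_Linf phi_b f2); last first.
  by apply: (aeS b_unimodular) => t ->; rewrite mul1r.
have up := hankelP phiJ_Linf fi; have vp := hankelP phi_Linf fi.
have w2 := defect_H2 phi_Linf phi_b f2.
apply: H2perp_eq0 => //.
apply: (H2perp_ae (H2perpB (H2perpZ (coef b 0) up) vp)); first exact: H2_L2.
apply: (aeS bc) => t bt; rewrite -bt.
by have := defectE phi b f t; rewrite -/phiJ => ->; rewrite addrC addKr.
Qed.

End symbol.
End kernel.

Theorem theorem4p2 (R : realType) (phi : R -> R[i])
  (phi_bounded : Lp +oo%E phi)
  (phi_hyponormal : hyponormal (toeplitz phi))
  (phi_finite_rank : finite_rank (selfcomm (toeplitz phi)))
  (ker_invariant :
     invariant_under (toeplitz phi) (kerH2 (selfcomm (toeplitz phi))))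
  (mul_ker_invariant : exists2 b, calE phi b &
     invariant_under (toeplitz phi)
       (mulspace b (kerH2 (selfcomm (toeplitz phi))))) :
  normal_op (toeplitz phi) \/ analytic_symbol phi.
Proof.
have [b Eb mul_inv] := mul_ker_invariant.
have [bu|nbu] := pselect (\forall t \ae circle_prob R, nsq (b t) = 1); last first.
  right; apply: (analytic_of_hankel0 phi_bounded ker_invariant Eb phi_finite_rank) => f.
  exact: (hankel0_of_nonunimodular phi_bounded Eb phi_finite_rank nbu).
have := fcoef0_b_le1 Eb bu; rewrite le_eqVlt => /orP[/eqP b1|b1]; last first.
  right; apply: (analytic_of_hankel0 phi_bounded ker_invariant Eb phi_finite_rank) => f.
  exact: (hankel0_of_unimodular phi_bounded Eb bu mul_inv b1).
left=> f f2; have [_ /aeqE Af] := ker_full_of_constant phi_bounded Eb bu b1 f2.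
by apply/aeqE; apply: (aeS Af) => t /eqP; rewrite subr_eq0 => /eqP.
Qed.
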